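(* Let $a\ne b$, $f\ne g$, $u\ne v$ be nonzero complex numbers with $abfguv=1$, relatively generic in the sense of the context. Let $C_1,C_2,C_3\subset GL(4,{\bf C})$ be the conjugacy classes with eigenvalues respectively $(a,a,b,b)$, $(f,f,g,g)$, $(u,u,v,v)$, such that to each of the eigenvalues $a$, $b$, $f$ there corresponds a single Jordan block of size $2$ and to each of the eigenvalues $g$, $u$, $v$ there correspond two Jordan blocks of size $1$. Let ${\cal V}=\{(M_1,M_2,M_3)~|~M_j\in C_j,~M_1M_2M_3=I\}$. Then $\dim{\cal V}=15$, which is the expected dimension $\dim C_1+\dim C_2+\dim C_3-4^2+1$.
   Context: Relatively generic means: the only non-genericity relation satisfied by the eigenvalues is the basic one $abfguv=1$; i.e. for integers $m\in\{1,2,3\}$ and $k_1,k_2,k_3$ with $0\le k_j\le2$, $0\le m-k_j\le2$, the equality $a^{k_1}b^{m-k_1}f^{k_2}g^{m-k_2}u^{k_3}v^{m-k_3}=1$ holds only for $m=2$, $k_1=k_2=k_3=1$. Dimensions are complex dimensions. *)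

(* Defs.v *)
(* MathComp; the complex numbers are R[i] for R : realType. *)
From HB Require Import structures.
From mathcomp Require Import all_boot all_order all_algebra.
From mathcomp Require Import mxred classical_sets reals complex mpoly.

Set Implicit Arguments.
Unset Strict Implicit.
Unset Printing Implicit Defensive.

Import Order.TTheory GRing.Theory Num.Theory.
Local Open Scope ring_scope.
Local Open Scope classical_set_scope.

Section Dimension.
Variables (K : fieldType) (V : vectType K).
Implicit Types X Z F : set V.

(* A polynomial function on V, written in the coordinates of a basis; the
   Zariski topology below does not depend on the choice of that basis. *)
Definition polyfun (p : {mpoly K[\dim {:V}]}) (x : V) : K :=
  p.@[fun i => coord (vbasis {:V}) i x].

Definition zariski_closed F : Prop :=
  exists S : set {mpoly K[\dim {:V}]},
    F = [set x | forall p, S p -> polyfun p x = 0].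

Definition closed_in X Z : Prop :=
  exists2 F, zariski_closed F & Z = X `&` F.

(* Irreducibility for the subspace topology on Z. *)
Definition irreducible Z : Prop :=
  Z !=set0 /\
  forall F1 F2, zariski_closed F1 -> zariski_closed F2 ->
    Z `<=` F1 `|` F2 -> Z `<=` F1 \/ Z `<=` F2.

(* A chain Z_0 < Z_1 < ... < Z_d in X; it has length d, hence d + 1 members. *)
Definition irreducible_chain X (d : nat) : Prop :=
  exists Z : nat -> set V,
    (forall i, (i <= d)%N -> closed_in X (Z i) /\ irreducible (Z i)) /\
    (forall i, (i < d)%N -> Z i `<` Z i.+1).

(* Krull dimension of X as a topological space (subspace Zariski topology);
   the empty set has no dimension in this sense. *)
Definition has_dim X (d : nat) : Prop :=
  irreducible_chain X d /\ forall e, irreducible_chain X e -> (e <= d)%N.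

End Dimension.

Section ConjugacyClasses.
Variable K : fieldType.

Definition jordan_block (n : nat) (a : K) : 'M[K]_n :=
  \matrix_(i, j) (if i == j then a else if (i.+1 == j)%N then 1 else 0).

(* No invertibility requirement: the classes used here have nonzero
   eigenvalues, so they lie in GL(n). *)
Definition conj_class (n : nat) (J : 'M[K]_n) : set 'M[K]_n :=
  [set M | similar_in unitmx M J].

Definition jordan_double (a : K) : 'M[K]_2 := jordan_block 2 a.

Definition jordan_pair (a : K) : 'M[K]_2 :=
  block_mx (jordan_block 1 a) 0 0 (jordan_block 1 a).

Definition class1 (a b : K) : set 'M[K]_4 :=
  @conj_class 4 (block_mx (jordan_double a) 0 0 (jordan_double b)).

Definition class2 (f g : K) : set 'M[K]_4 :=
  @conj_class 4 (block_mx (jordan_double f) 0 0 (jordan_pair g)).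

Definition class3 (u v : K) : set 'M[K]_4 :=
  @conj_class 4 (block_mx (jordan_pair u) 0 0 (jordan_pair v)).

Definition triples (C1 C2 C3 : set 'M[K]_4) :
    set ('M[K]_4 * 'M[K]_4 * 'M[K]_4)%type :=
  [set M | [/\ C1 M.1.1, C2 M.1.2, C3 M.2 &
               M.1.1 *m M.1.2 *m M.2 = 1%:M]].

Definition relatively_generic (a b f g u v : K) : Prop :=
  forall m k1 k2 k3 : nat,
    (1 <= m <= 3)%N ->
    (k1 <= 2)%N -> (k1 <= m)%N -> (m - k1 <= 2)%N ->
    (k2 <= 2)%N -> (k2 <= m)%N -> (m - k2 <= 2)%N ->
    (k3 <= 2)%N -> (k3 <= m)%N -> (m - k3 <= 2)%N ->
    a ^+ k1 * b ^+ (m - k1) * f ^+ k2 * g ^+ (m - k2)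
      * u ^+ k3 * v ^+ (m - k3) = 1 ->
    [/\ m = 2, k1 = 1, k2 = 1 & k3 = 1]%N.

End ConjugacyClasses.

(* Main.v *)
(* The eigenvalue conditions leave no room for irreducible triples.  Let U be the
   plane spanned by the generalized a-eigenvectors of M1 and G the g-eigenplane
   of M2 (matrices act on row vectors).  Genericity forces U and G to be
   complementary, and in a suitable basis adapted to them M1 and M2 become 2 x 2
   matrices over the dual numbers K[nu]; the relation (M3 - u)(M3 - v) = 0 reduces
   the problem to a product of three unipotents of GL(2), which must commute.  So
   every triple is conjugate to a member of an explicit one-parameter family, with
   stabilizer the units of K[nu], of dimension 2; hence 16 - 2 + 1 = 15.

   Dimensions are computed with the slice 1 + W, W a complement of the centralizer:
   conjugation by this slice dominates the orbit and has a rational inverse there.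
   Flags of coordinate subspaces then give long chains, while a chain of length e
   yields e algebraically independent functions, which a count of monomials bounds
   by the number of parameters. *)
From HB Require Import structures.
Require Import Defs.
From mathcomp Require Import all_boot all_order all_algebra.
From mathcomp Require Import mxred classical_sets boolp reals complex mpoly.
From mathcomp Require Import ring zify.

Set Implicit Arguments.
Unset Strict Implicit.
Unset Printing Implicit Defensive.

Import Order.TTheory GRing.Theory Num.Theory.
Local Open Scope ring_scope.
Local Open Scope classical_set_scope.

(** * Polynomial and rational functions *)

Section PolynomialFunctions.
Variable K : fieldType.
Implicit Types T V U : vectType K.

(** The parameter has a simple origin. Up to the factors a, b, f, the three unipotents are 1 + x nu
    with nilpotent parts x equal to 1/a, s and -(s + 1/a), whose sum is zero. The first is fixed by
    the choice of basis; s = 0 and s = -1/a are excluded because there M1 or M2 would lose a Jordan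
    block of size 2. The third matrix is eliminated from the start: M1 M2 satisfies a quadratic
    equation, so its inverse is an affine function of it. Letting the whole group act on the family
    would bound chains only by 17; the slice removes the excess, because a single plane of matrices
    centralizes all normal forms at once. Conversely, one orbit accounts for chains of length 14
    only. The missing step, from an orbit to the whole variety, rests on a polynomial that vanishes
    on that orbit but not on the family. Orbits and families arise as images, not as closed sets, so
    irreducibility and strict inclusion are tested on polynomial functions, and closures are taken
    only when a chain is assembled. *)

Definition polyf T (f : T -> K) : Prop :=
  exists p : {mpoly K[\dim {:T}]}, forall x, f x = polyfun p x.

(** Nothing is asked where [h] vanishes, so inverses and [invmx] qualify whatever default values
    they take there. *)
Definition ratf T (h f : T -> K) : Prop :=
  exists N P, polyf P /\ forall x, h x != 0 -> f x * h x ^+ N = P x.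

Definition ratmap T V (h : T -> K) (F : T -> V) : Prop :=
  forall i, ratf h (fun x => coord (vbasis {:V}) i (F x)).

Lemma eq_polyf T (f g : T -> K) : f =1 g -> polyf f -> polyf g.
Proof. by move=> /funext->. Qed.

Lemma polyf_polyfun T p : polyf (@polyfun K T p).
Proof. by exists p. Qed.

Lemma polyf_cst T c : polyf (fun=> c : K) (T := T).
Proof. by exists c%:MP => x; rewrite /polyfun mevalC. Qed.

Lemma polyfD T (f g : T -> K) :
  polyf f -> polyf g -> polyf (fun x => f x + g x).
Proof.
by move=> [p hp] [q hq]; exists (p + q) => x; rewrite /polyfun mevalD hp hq.
Qed.

Lemma polyfM T (f g : T -> K) :
  polyf f -> polyf g -> polyf (fun x => f x * g x).
Proof.
by move=> [p hp] [q hq]; exists (p * q) => x; rewrite /polyfun mevalM hp hq.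
Qed.

Lemma polyfX T (f : T -> K) n : polyf f -> polyf (fun x => f x ^+ n).
Proof.
by move=> [p hp]; exists (p ^+ n) => x; rewrite /polyfun rmorphXn /= hp.
Qed.

Lemma polyf_coord T i : polyf (fun x : T => coord (vbasis {:T}) i x).
Proof. by exists 'X_i => x; rewrite /polyfun mevalXU. Qed.

Section Ratf.
Variables (T : vectType K) (h : T -> K) (hp : polyf h).

Lemma eq_ratf f g : f =1 g -> ratf h f -> ratf h g.
Proof. by move=> /funext->. Qed.

Lemma polyf_ratf f : polyf f -> ratf h f.
Proof. by move=> fp; exists 0, f; split=> // x _; rewrite mulr1. Qed.

Lemma eq_ratf_in f g :
  (forall x, h x != 0 -> f x = g x) -> ratf h f -> ratf h g.
Proof.
move=> fg [N [P [Pp fP]]]; exists N, P; split=> // x hx.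
by rewrite -fg // fP.
Qed.

Lemma ratf_cst c : ratf h (fun=> c).
Proof. exact/polyf_ratf/polyf_cst. Qed.

Lemma ratfD f g : ratf h f -> ratf h g -> ratf h (fun x => f x + g x).
Proof.
move=> [N [P [Pp fP]]] [M [Q [Qp gQ]]].
exists (N + M)%N, (fun x => P x * h x ^+ M + Q x * h x ^+ N); split.
  by apply: polyfD; apply: polyfM => //; apply: polyfX.
by move=> x hx; rewrite -fP // -gQ // exprD; ring.
Qed.

Lemma ratfM f g : ratf h f -> ratf h g -> ratf h (fun x => f x * g x).
Proof.
move=> [N [P [Pp fP]]] [M [Q [Qp gQ]]].
exists (N + M)%N, (fun x => P x * Q x); split; first exact: polyfM.
by move=> x hx; rewrite -fP // -gQ // exprD; ring.
Qed.

Lemma ratfV : ratf h (fun x => (h x)^-1).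
Proof.
exists 1, (fun=> 1); split; first exact: polyf_cst.
by move=> x hx; rewrite mulVf.
Qed.

Lemma ratf_sum I (r : seq I) (P : pred I) (F : I -> T -> K) :
  (forall i, P i -> ratf h (F i)) -> ratf h (fun x => \sum_(i <- r | P i) F i x).
Proof.
move=> Fr; elim: r => [|i r IHr].
  by apply: eq_ratf (ratf_cst 0) => x; rewrite big_nil.
case Pi: (P i); last by apply: eq_ratf IHr => x; rewrite big_cons Pi.
by apply: eq_ratf (ratfD (Fr i Pi) IHr) => x; rewrite big_cons Pi.
Qed.

Lemma ratf_prod I (r : seq I) (P : pred I) (F : I -> T -> K) :
  (forall i, P i -> ratf h (F i)) -> ratf h (fun x => \prod_(i <- r | P i) F i x).
Proof.
move=> Fr; elim: r => [|i r IHr].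
  by apply: eq_ratf (ratf_cst 1) => x; rewrite big_nil.
case Pi: (P i); last by apply: eq_ratf IHr => x; rewrite big_cons Pi.
by apply: eq_ratf (ratfM (Fr i Pi) IHr) => x; rewrite big_cons Pi.
Qed.

Lemma ratfX f n : ratf h f -> ratf h (fun x => f x ^+ n).
Proof.
move=> fr; apply: eq_ratf (@ratf_prod _ (index_enum 'I_n) predT (fun=> f) _) => //.
by move=> x; rewrite prodr_const card_ord.
Qed.

Lemma ratf_det n (F : T -> 'M[K]_n) :
  (forall i j, ratf h (fun x => F x i j)) -> ratf h (fun x => \det (F x)).
Proof.
move=> Fr; apply: ratf_sum => s _; apply: ratfM; first exact: ratf_cst.
by apply: ratf_prod => i _; apply: Fr.
Qed.

Lemma ratf_adj n (F : T -> 'M[K]_n) i j :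
  (forall i j, ratf h (fun x => F x i j)) -> ratf h (fun x => (\adj (F x)) i j).
Proof.
move=> Fr; under eq_fun do rewrite mxE.
apply: ratfM; first exact: ratf_cst.
by apply: ratf_det => k l; under eq_fun do rewrite !mxE; apply: Fr.
Qed.

Lemma ratf_meval n (p : {mpoly K[n]}) (f : 'I_n -> T -> K) :
  (forall i, ratf h (f i)) -> ratf h (fun x => p.@[fun i => f i x]).
Proof.
move=> fr; apply: eq_ratf (fun x => esym (mevalE _ p)) _.
apply: ratf_sum => m _; apply: ratfM; first exact: ratf_cst.
by apply: ratf_prod => i _; apply: ratfX.
Qed.

Lemma ratf_polyfun V (F : T -> V) p :
  ratmap h F -> ratf h (fun x => polyfun p (F x)).
Proof.
by move=> Fr; apply: ratf_meval.
Qed.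

Lemma ratf_comp V (F : T -> V) f :
  polyf f -> ratmap h F -> ratf h (fun x => f (F x)).
Proof. by case=> p /funext -> /ratf_polyfun. Qed.

Lemma ratmap_sum V I (r : seq I) (c : I -> T -> K) (e : I -> V) :
  (forall i, ratf h (c i)) -> ratmap h (fun x => \sum_(i <- r) c i x *: e i).
Proof.
move=> cr j; under eq_fun do rewrite linear_sum.
apply: ratf_sum => i _; under eq_fun do rewrite linearZ.
by apply: ratfM => //; apply: ratf_cst.
Qed.

Lemma ratmap_mx m n (F : T -> 'M[K]_(m, n)) :
  (forall i j, ratf h (fun x => F x i j)) -> ratmap h F.
Proof.
move=> Fr; have -> : F = fun x => \sum_(ij : 'I_m * 'I_n)
    F x ij.1 ij.2 *: delta_mx ij.1 ij.2.
  apply/funext => x; rewrite {1}[F x]matrix_sum_delta.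
  by rewrite pair_bigA.
by apply: ratmap_sum => -[i j].
Qed.

End Ratf.

(** With denominator 1, polynomial maps inherit the closure properties of rational ones. *)
Definition polymap T V (F : T -> V) := ratmap (fun=> 1) F.

Lemma ratf1_polyf T (f : T -> K) : ratf (fun=> 1) f -> polyf f.
Proof.
case=> N [P [Pp fP]]; apply: eq_polyf Pp => x.
by rewrite -fP ?oner_neq0 // expr1n mulr1.
Qed.

Lemma polyf_meval T n (p : {mpoly K[n]}) (f : 'I_n -> T -> K) :
  (forall i, polyf (f i)) -> polyf (fun x => p.@[fun i => f i x]).
Proof.
move=> fp; apply: ratf1_polyf; apply: (ratf_meval (polyf_cst _ _)) => i.
exact: polyf_ratf.
Qed.

Lemma polyf_det T n (F : T -> 'M[K]_n) :
  (forall i j, polyf (fun x => F x i j)) -> polyf (fun x => \det (F x)).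
Proof.
move=> Fp; apply: ratf1_polyf; apply: (ratf_det (polyf_cst _ _)) => i j.
exact/polyf_ratf/Fp.
Qed.

Lemma polyf_adj T n (F : T -> 'M[K]_n) i j :
  (forall i j, polyf (fun x => F x i j)) -> polyf (fun x => (\adj (F x)) i j).
Proof.
move=> Fp; apply: ratf1_polyf; apply: (@ratf_adj _ _ (polyf_cst _ _)) => k l.
exact/polyf_ratf/Fp.
Qed.

Lemma polyf_sum T I (r : seq I) (P : pred I) (F : I -> T -> K) :
  (forall i, P i -> polyf (F i)) -> polyf (fun x => \sum_(i <- r | P i) F i x).
Proof.
move=> Fp; apply: ratf1_polyf; apply: (ratf_sum (polyf_cst _ _)) => i Pi.
exact/polyf_ratf/Fp.
Qed.

Lemma polyf_linear T (f : T -> K) :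
  (forall a x y, f (a *: x + y) = a * f x + f y) -> polyf f.
Proof.
move=> fl; pose l : T -> K^o := f.
have ll : linear l by move=> a x y; rewrite /l fl.
pose ll' := GRing.isLinear.Build _ _ _ _ l ll.
pose L : {linear T -> K^o} := HB.pack l ll'.
have fE x : f x = \sum_i coord (vbasis {:T}) i x * f (vbasis {:T})`_i.
  rewrite {1}(coord_vbasis (memvf x)).
  change (L (\sum_i coord (vbasis {:T}) i x *: (vbasis {:T})`_i) = 
    \sum_i coord (vbasis {:T}) i x * L (vbasis {:T})`_i).
  by rewrite linear_sum; apply: eq_bigr => i _; rewrite linearZ.
rewrite (funext fE); apply: ratf1_polyf.
apply: (ratf_sum (polyf_cst _ _)) => i _.
by apply: polyf_ratf; apply: polyfM; [exact: polyf_coord | exact: polyf_cst].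
Qed.

Lemma polymap_linear T V (F : T -> V) : linear F -> polymap F.
Proof.
move=> Fl i; apply/polyf_ratf/polyf_linear => a x y.
by rewrite Fl linearP.
Qed.

Lemma polymap_cst T V (x : V) : polymap (fun=> x) (T := T).
Proof. by move=> i; apply: ratf_cst. Qed.

Lemma polymapD T V (F G : T -> V) :
  polymap F -> polymap G -> polymap (fun t => F t + G t).
Proof.
move=> Fp Gp i; apply: (eq_ratf _ (ratfD (polyf_cst _ _) (Fp i) (Gp i))) => t.
by rewrite linearD.
Qed.

Lemma polyf_comp T V (F : T -> V) f :
  polyf f -> polymap F -> polyf (fun x => f (F x)).
Proof. by move=> fp Fp; apply: ratf1_polyf; apply: (ratf_comp (polyf_cst _ _)) Fp. Qed.

Lemma polymap_ratmap T V (h : T -> K) (F : T -> V) : polymap F -> ratmap h F.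
Proof. by move=> Fp i; apply/polyf_ratf/ratf1_polyf/Fp. Qed.

Lemma ratmap_comp T U V (h : T -> K) (F : T -> U) (G : U -> V) :
  polyf h -> polymap G -> ratmap h F -> ratmap h (fun x => G (F x)).
Proof.
move=> hp Gp Fr i; apply: (ratf_comp (f := fun y => coord _ i (G y)) hp _ Fr).
exact/ratf1_polyf/Gp.
Qed.

(** Expanding both arguments in bases serves the matrix product and both actions of a bimodule
    alike. *)
Lemma ratmap_bilinear T U1 U2 V (h : T -> K) (B : U1 -> U2 -> V)
    (F : T -> U1) (G : T -> U2) : polyf h ->
  (forall y, linear (B^~ y)) -> (forall x, linear (B x)) ->
  ratmap h F -> ratmap h G -> ratmap h (fun x => B (F x) (G x)).
Proof.
move=> hp Bl Br Fr Gr.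
pose Bl' y := GRing.isLinear.Build _ _ _ _ (B^~ y) (Bl y).
pose Br' x := GRing.isLinear.Build _ _ _ _ (B x) (Br x).
pose BL y : {linear U1 -> V} := HB.pack (B^~ y) (Bl' y).
pose BR x : {linear U2 -> V} := HB.pack (B x) (Br' x).
pose e1 := vbasis {:U1}; pose e2 := vbasis {:U2}.
have BE x y : B x y = \sum_(ij : 'I_(\dim {:U1}) * 'I_(\dim {:U2}))
    (coord e1 ij.1 x * coord e2 ij.2 y) *: B e1`_ij.1 e2`_ij.2.
  rewrite -(pair_bigA _ (fun i j => (coord e1 i x * coord e2 j y) *:
    B e1`_i e2`_j)) /=.
  rewrite {1}(coord_vbasis (memvf x)) -/e1.
  rewrite -[LHS]/(BL y _) linear_sum; apply: eq_bigr => i _.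
  rewrite linearZ /= {1}(coord_vbasis (memvf y)) -/e2.
  rewrite -[B _ _]/(BR e1`_i _) linear_sum scaler_sumr; apply: eq_bigr => j _.
  by rewrite linearZ /= scalerA.
rewrite (funext (fun x => BE (F x) (G x))); apply: ratmap_sum => // ij.
by apply: ratfM.
Qed.

Lemma polymap_comp T U V (F : T -> U) (G : U -> V) :
  polymap F -> polymap G -> polymap (fun x => G (F x)).
Proof. by move=> Fp Gp; apply: ratmap_comp Gp Fp; apply: polyf_cst. Qed.

Lemma polymap_mulmx T m n p (F : T -> 'M[K]_(m, n)) (G : T -> 'M[K]_(n, p)) :
  polymap F -> polymap G -> polymap (fun x => F x *m G x).
Proof.
apply: ratmap_bilinear => [|y c x x'|x c y y']; first exact: polyf_cst.
  by rewrite mulmxDl scalemxAl.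
by rewrite mulmxDr scalemxAr.
Qed.

Lemma polymap_pair T U V (F : T -> U) (G : T -> V) :
  polymap F -> polymap G -> polymap (fun x => (F x, G x)).
Proof.
move=> Fp Gp.
have -> : (fun x => (F x, G x)) = (fun x => (F x, 0 : V) + (0 : U, G x)).
  by apply/funext => x; congr (_, _); rewrite ?addr0 ?add0r.
apply: polymapD.
  apply: (polymap_comp (G := fun y => (y, 0 : V)) Fp); apply: polymap_linear.
  by move=> c x y; congr (_, _); rewrite /= ?scaler0 ?addr0.
apply: (polymap_comp (G := fun y => (0 : U, y)) Gp); apply: polymap_linear.
by move=> c x y; congr (_, _); rewrite /= ?scaler0 ?addr0.
Qed.

End PolynomialFunctions.

(** * Counting monomials *)

Section Counting.
Variable K : fieldType.

Lemma msizeM_leq n (p q : {mpoly K[n]}) d e :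
  (msize p <= d.+1)%N -> (msize q <= e.+1)%N -> (msize (p * q) <= (d + e).+1)%N.
Proof.
have [->|p0] := eqVneq p 0; first by rewrite mul0r msize0.
have [->|q0] := eqVneq q 0; first by rewrite mulr0 msize0.
rewrite msizeM //; move: (msize p) (msize q) => s t; lia.
Qed.

Lemma msize_prod_leq n (I : Type) (r : seq I) (p : I -> {mpoly K[n]}) d :
  (forall i, msize (p i) <= d.+1)%N ->
  (msize (\prod_(i <- r) p i) <= (size r * d).+1)%N.
Proof.
move=> pd; elim: r => [|i r IHr]; first by rewrite big_nil msize1.
by rewrite big_cons /= mulSn; apply: msizeM_leq.
Qed.

Lemma msizeX_leq n (p : {mpoly K[n]}) d k :
  (msize p <= d.+1)%N -> (msize (p ^+ k) <= (k * d).+1)%N.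
Proof.
move=> pd; have := @msize_prod_leq n _ (iota 0 k) (fun=> p) d (fun=> pd).
by rewrite size_iota big_const_seq count_predT size_iota -Monoid.iteropE.
Qed.

Lemma card_bmultinom n d : (#|{: 'X_{1..n < d.+1}}| <= d.+1 ^ n)%N.
Proof.
pose F (m : 'X_{1..n < d.+1}) : {ffun 'I_n -> 'I_d.+1} :=
  [ffun i => inord ((m : 'X_{1..n}) i)].
have Fi : injective F.
  move=> m1 m2 /ffunP E; apply/val_inj/mnmP => i /=.
  have lt (m : 'X_{1..n < d.+1}) : ((m : 'X_{1..n}) i < d.+1)%N.
    by apply: leq_ltn_trans (bmdeg m); rewrite mdegE (bigD1 i) //= leq_addr.
  by have := congr1 val (E i); rewrite !ffunE /= !inordK.
by have := leq_card F Fi; rewrite card_ffun !card_ord.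
Qed.

Lemma linear_relation n (I : finType) (p : I -> {mpoly K[n]}) d :
  (forall i, msize (p i) <= d.+1)%N -> (d.+1 ^ n < #|I|)%N ->
  exists2 c : I -> K, \sum_i c i *: p i = 0 & exists i, c i != 0.
Proof.
move=> pd dI; pose J := {: 'X_{1..n < d.+1}}.
pose M := \matrix_(i < #|I|, j < #|J|)
   (p (enum_val i))@_(enum_val j : 'X_{1..n}).
have : kermx M != 0.
  rewrite kermx_eq0 /row_free; apply: contraTneq dI => rM.
  by rewrite -leqNgt -rM (leq_trans (rank_leq_col _)) // card_bmultinom.
case/rowV0Pn => v /sub_kermxP vM v0.
exists (fun i => v 0 (enum_rank i)).
  apply/mpolyP => m; rewrite mcoeff0 raddf_sum /=.
  case: (ltnP (mdeg m) d.+1) => [lt_md|le_dm]; last first.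
    apply: big1 => i _; rewrite mcoeffZ memN_msupp_eq0 ?mulr0 //.
    by apply: msize_mdeg_ge; apply: leq_trans (pd i) le_dm.
  have := congr1 (fun A : 'rV_#|J| => A 0 (enum_rank (BMultinom lt_md))) vM.
  rewrite !mxE => {2}<-; rewrite (reindex (@enum_val I xpredT)) /=; last first.
    by apply: onW_bij; apply: enum_val_bij.
  by apply: eq_bigr => i _; rewrite mcoeffZ !mxE enum_valK enum_rankK.
case/rV0Pn: v0 => j vj; exists (enum_val j); by rewrite enum_valK.
Qed.

(* With M - 1 = (eD+1)^n, the M^e monomials of partial degrees < M outnumber
   the monomials of degree <= eDM in n variables. *)
Lemma counting_bound e n D (M := ((e * D).+1 ^ n).+1) :
  (n < e)%N -> ((e * M * D).+1 ^ n < M ^ e)%N.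
Proof.
move=> ne; apply: (@leq_trans (M ^ n.+1)); last by rewrite leq_pexp2l.
apply: (@leq_ltn_trans ((e * D).+1 ^ n * M ^ n)).
  rewrite -expnMn; case: (posnP n) => [->//|n0].
  by rewrite leq_exp2r // mulSn mulnAC -add1n leq_add2r.
by rewrite expnS ltn_mul2r expn_gt0 /= ltnSn.
Qed.

Lemma algebraic_relation (T : vectType K) (h : T -> K) e
    (F : 'I_e -> T -> K) :
  polyf h -> (\dim {:T} < e)%N -> (forall i, ratf h (F i)) ->
  exists2 P : {mpoly K[e]}, P != 0 &
    forall x, h x != 0 -> P.@[fun i => F i x] = 0.
Proof.
move=> hp ne Fr; set n := \dim {:T} in ne.
have [N_ Fr1] := choice Fr.
pose N := \max_i N_ i.
have {}Fr1 i : exists p : {mpoly K[n]}, forall x, h x != 0 ->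
    F i x * h x ^+ N = polyfun p x.
  have [P [Pp FP]] := Fr1 i.
  have [p pE] : polyf (fun x => P x * h x ^+ (N - N_ i)).
    by apply: polyfM => //; apply: polyfX.
  exists p => x hx; rewrite -pE -FP // -mulrA -exprD subnKC //.
  exact: (@leq_bigmax _ N_ i).
have [p pE] := choice Fr1.
have [q qE] : polyf (fun x => h x ^+ N) by apply: polyfX.
pose D := maxn (msize q) (\max_i msize (p i)).
have pD i : (msize (p i) <= D.+1)%N.
  by rewrite ltnW // ltnS leq_max (@leq_bigmax _ (fun i => msize (p i)) i) orbT.
have qD : (msize q <= D.+1)%N by rewrite ltnW // ltnS leq_max leqnn.
pose M := ((e * D).+1 ^ n).+1.
pose I := {ffun 'I_e -> 'I_M}.
(* Padding with the denominator [q] makes [mon m] the monomial of exponent [m] in the [F i], times a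
   power of [h] that is the same for every [m]. A linear relation between the [mon m] thus passes to
   the functions [F i]. *)
pose mon (m : I) : {mpoly K[n]} := \prod_i (p i ^+ m i * q ^+ (M - m i)).
have monD m : (msize (mon m) <= (e * M * D).+1)%N.
  have {1}<- : size (index_enum 'I_e) = e.
    by rewrite [index_enum _]unlock -enumT size_enum_ord.
  rewrite -mulnA; apply: msize_prod_leq => i.
  apply: leq_trans (msizeM_leq (msizeX_leq _ (pD i)) (msizeX_leq _ qD)) _.
  by rewrite -mulnDl subnKC // ltnW.
have [c c0 [m0 cm0]] : exists2 c : I -> K, \sum_i c i *: mon i = 0 &
    exists i, c i != 0.
  apply: linear_relation monD _; rewrite card_ffun !card_ord.
  exact: counting_bound.
pose mn (m : I) := [multinom (m i : nat) | i < e].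
have mn_inj : injective mn.
  move=> m1 m2 /mnmP E; apply/ffunP => i; apply: val_inj.
  by have := E i; rewrite !mnmE.
exists (\sum_m c m *: 'X_[mn m]).
  apply: contraNneq cm0 => /(congr1 (fun P : {mpoly K[e]} => P@_(mn m0))).
  rewrite mcoeff0 raddf_sum /= (bigD1 m0) //= mcoeffZ mcoeffX eqxx mulr1.
  rewrite big1 ?addr0 => [->//|m mm0].
  by rewrite mcoeffZ mcoeffX (inj_eq mn_inj) (negbTE mm0) mulr0.
move=> x hx; have := congr1 (fun P => polyfun P x) c0.
rewrite /polyfun meval0 rmorph_sum /= => E.
rewrite rmorph_sum /=.
pose H := h x ^+ N ^+ (M * e).
have H0 : H != 0 by rewrite !expf_neq0.
apply: (mulIf H0); rewrite mul0r; apply: etrans E; rewrite mulr_suml.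
apply: eq_bigr => m _; rewrite !mevalZ -mulrA; congr (_ * _).
rewrite mevalX /mon rmorph_prod /= /H exprM.
have -> : h x ^+ N ^+ M ^+ e = \prod_(i < e) h x ^+ N ^+ M.
  by rewrite prodr_const card_ord.
rewrite -big_split /=; apply: eq_bigr => i _.
rewrite mnmE rmorphM !rmorphXn /= -[meval _ (p i)]/(polyfun (p i) x) -pE //.
rewrite -[meval _ q]/(polyfun q x) -qE exprMn -mulrA -exprD subnKC // ltnW //.
Qed.

End Counting.

(** * Irreducible sets and chains *)

Section Irreducibility.
Variable K : numFieldType.
Implicit Types T V : vectType K.

(** In characteristic zero the integers below [size p] are distinct, hence too many roots. *)
Lemma poly_eq0_horner (p : {poly K}) : (forall t, p.[t] = 0) -> p = 0.
Proof.
move=> p0; apply/eqP; apply: contraT => pn0.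
pose s : seq K := [seq i%:R | i <- iota 0 (size p)].
have := max_poly_roots pn0 (rs := s).
rewrite size_map size_iota ltnn; apply.
  by apply/allP => x _; rewrite /root p0.
by rewrite map_inj_uniq ?iota_uniq // => i j /eqP; rewrite eqr_nat => /eqP.
Qed.

Lemma polyf_line T (f : T -> K) x d : polyf f ->
  exists p : {poly K}, forall t, f (x + t *: d) = p.[t].
Proof.
case=> P fP; set n := \dim {:T} in P fP.
pose l (i : 'I_n) : {poly K} :=
  (coord (vbasis {:T}) i x)%:P + (coord (vbasis {:T}) i d) *: 'X.
exists (mmap (@polyC K) l P) => t.
rewrite fP /polyfun mevalE /mmap horner_sum; apply: eq_bigr => m _.
rewrite hornerM hornerC /mmap1 horner_prod; congr (_ * _).
apply: eq_bigr => i _; rewrite horner_exp hornerD hornerC hornerZ hornerX.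
by rewrite linearD linearZ /= [t * _]mulrC.
Qed.

(** On the line through the two given points, both functions become nonzero polynomials in one
    variable. *)
Lemma polyf_neq0M T (f g : T -> K) : polyf f -> polyf g ->
  (exists x, f x != 0) -> (exists x, g x != 0) ->
  exists x, (f x != 0) && (g x != 0).
Proof.
move=> fp gp [x fx] [y gy]; apply: contrapT => fg0.
have [p pE] := polyf_line x (y - x) fp.
have [q qE] := polyf_line x (y - x) gp.
have : p * q = 0.
  apply: poly_eq0_horner => t; rewrite hornerM -pE -qE; apply/eqP.
  apply: contra_notT fg0; rewrite mulf_eq0 negb_or => fgt.
  by exists (x + t *: (y - x)).
move/eqP; rewrite mulf_eq0 => /orP[] /eqP E.
  by move: fx; have := pE 0; rewrite scale0r addr0 E horner0 => ->; rewrite eqxx.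
by move: gy; have := qE 1; rewrite scale1r subrKC E horner0 => ->; rewrite eqxx.
Qed.

Lemma zariski_closed_zeros V (f : V -> K) :
  polyf f -> zariski_closed [set x | f x = 0].
Proof.
case=> p fp; exists [set p]; apply/seteqP; split=> x /=.
  by move=> fx _ ->; rewrite -fp.
by move=> /(_ p erefl); rewrite fp.
Qed.

(** With its converse below, this turns irreducibility into primality of the vanishing ideal. *)
Lemma irreducible_prime V (Z : set V) (f g : V -> K) :
  irreducible Z -> polyf f -> polyf g ->
  (forall x, Z x -> f x * g x = 0) ->
  (forall x, Z x -> f x = 0) \/ (forall x, Z x -> g x = 0).
Proof.
move=> [_ Zi] fp gp fg0.
apply: (Zi _ _ (zariski_closed_zeros fp) (zariski_closed_zeros gp)) => x Zx /=.
by move/eqP: (fg0 x Zx); rewrite mulf_eq0 => /orP[] /eqP; [left | right].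
Qed.

Lemma prime_irreducible V (Z : set V) : Z !=set0 ->
  (forall f g : V -> K, polyf f -> polyf g ->
    (forall x, Z x -> f x * g x = 0) ->
    (forall x, Z x -> f x = 0) \/ (forall x, Z x -> g x = 0)) ->
  irreducible Z.
Proof.
move=> Z0 Zp; split=> // F1 F2 [S1 ->] [S2 ->] Z12.
apply: contrapT => /not_orP[].
move=> /existsNP[x /not_implyP[Zx /existsNP[p /not_implyP[S1p px]]]].
move=> /existsNP[y /not_implyP[Zy /existsNP[q /not_implyP[S2q qy]]]].
have [z Zz||] := Zp _ _ (polyf_polyfun p) (polyf_polyfun q).
- by case: (Z12 z Zz) => /= [/(_ p S1p)|/(_ q S2q)] ->; rewrite ?mul0r ?mulr0.
- by move=> /(_ x Zx).
- by move=> /(_ y Zy).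
Qed.

(** Functions that do not vanish identically on the image pull back, up to powers of [h], to nonzero
    polynomials on an affine space; these have a common nonvanishing point, even off the zeros of
    [h]. *)
Lemma irreducible_image T V (h : T -> K) (F : T -> V) :
  polyf h -> (exists x, h x != 0) -> ratmap h F ->
  irreducible [set F x | x in [set x | h x != 0]].
Proof.
move=> hp h0 Fr; apply: prime_irreducible.
  by case: h0 => x hx; exists (F x), x.
move=> f g fp gp fg0.
have [N [P [Pp fP]]] := ratf_comp hp fp Fr.
have [M [Q [Qp gQ]]] := ratf_comp hp gp Fr.
apply: contrapT => /not_orP[].
move=> /existsNP[_ /not_implyP[[x hx <-] /eqP fx]].
move=> /existsNP[_ /not_implyP[[y hy <-] /eqP gy]].
have [z /andP[Pz /andP[Qz hz]]] :
    exists z, (P z != 0) && ((Q z != 0) && (h z != 0)).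
  have Px : P x != 0 by rewrite -fP // mulf_neq0 ?expf_neq0.
  have Qy : Q y != 0 by rewrite -gQ // mulf_neq0 ?expf_neq0.
  have [w /andP[Qw hw]] := polyf_neq0M Qp hp (ex_intro _ y Qy) h0.
  have [] := polyf_neq0M Pp (polyfM Qp hp) (ex_intro _ x Px).
    by exists w; rewrite mulf_neq0.
  by move=> z; rewrite mulf_eq0 negb_or => ?; exists z.
have := fg0 (F z) (ex_intro2 _ _ z hz erefl); apply/eqP.
have fz : f (F z) != 0.
  by apply: contraNneq Pz => fz; rewrite -fP // fz mul0r.
have gz : g (F z) != 0.
  by apply: contraNneq Qz => gz; rewrite -gQ // gz mul0r.
exact: mulf_neq0.
Qed.

End Irreducibility.

(** * Chains and algebraic independence *)

Section Chains.
Variable K : numFieldType.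
Implicit Types T V : vectType K.

(** Stronger than strict inclusion: it keeps the Zariski closures distinct. *)
Definition separated V (Y Z : set V) :=
  exists f : V -> K, [/\ polyf f, forall x, Y x -> f x = 0 &
    exists2 x, Z x & f x != 0].

Definition zariski_closure V (Z : set V) : set V :=
  [set x | forall f : V -> K, polyf f -> (forall z, Z z -> f z = 0) -> f x = 0].

Lemma zariski_closure_closed V (Z : set V) :
  zariski_closed (zariski_closure Z).
Proof.
exists [set p | forall z, Z z -> polyfun p z = 0].
apply/seteqP; split=> x /= Zx.
  by move=> p; apply: Zx; apply: polyf_polyfun.
move=> f [p fp] fZ; rewrite fp; apply: Zx => z Zz.
by rewrite -fp fZ.
Qed.

Lemma sub_zariski_closure V (Z : set V) : Z `<=` zariski_closure Z.
Proof. by move=> x Zx f _; apply. Qed.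

(* The members need not be closed in X: their closures in X are used. *)
Lemma irreducible_chain_of_separated V (X : set V) (Z : nat -> set V) d :
  (forall i, (i <= d)%N -> irreducible (Z i) /\ Z i `<=` X) ->
  (forall i, (i < d)%N -> Z i `<=` Z i.+1 /\ separated (Z i) (Z i.+1)) ->
  irreducible_chain X d.
Proof.
move=> Zi Zs; exists (fun i => X `&` zariski_closure (Z i)).
split=> i ile.
  have [iZ ZX] := Zi i ile; split.
    by exists (zariski_closure (Z i)) => //; apply: zariski_closure_closed.
  apply: prime_irreducible.
    by case: iZ => -[x Zx] _; exists x; split; [exact: ZX|exact: sub_zariski_closure].
  move=> f g fp gp fg0.
  have [x Zx|f0|g0] := irreducible_prime iZ fp gp.
  - by apply: fg0; split; [exact: ZX|exact: sub_zariski_closure].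
  - by left=> x [_]; apply.
  - by right=> x [_]; apply.
have [Zle [f [fp f0 [x Zx fx]]]] := Zs i ile.
split=> [|sub].
  by move=> y [Xy cy]; split=> // g gp gZ; apply: cy => // z /Zle /gZ.
have [_ ZX] := Zi i.+1 ile.
have [] := sub x (conj (ZX x Zx) (@sub_zariski_closure V (Z i.+1) x Zx)).
by move=> _ /(_ f fp f0) /eqP; apply/negP.
Qed.

Lemma meval_muni n (P : {mpoly K[n.+1]}) (v : 'I_n.+1 -> K) :
  P.@[v] = (map_poly (meval (fun i => v (widen_ord (leqnSn n) i))) (muni P)).[v ord_max].
Proof.
rewrite mevalE muniE raddf_sum /= horner_sum; apply: eq_bigr => m _.
pose e := meval (fun i => v (widen_ord (leqnSn n) i)).
rewrite -/e; set w := [multinom _ | _ < _].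
rewrite [X in X.[_]](_ : _ = e (P@_m *: 'X_[w]) *: 'X^(m ord_max)); last first.
  by rewrite map_polyZ map_polyXn.
rewrite hornerZ hornerXn /e mevalZ mevalX -mulrA big_ord_recr /=.
by congr (_ * (_ * _)); apply: eq_bigr => i _; rewrite mnmE.
Qed.

Lemma muni_inj n (P : {mpoly K[n.+1]}) : muni P = 0 -> P = 0.
Proof.
move=> Pz; apply/mpolyP => m; rewrite mcoeff0.
pose rs (m : 'X_{1..n.+1}) := [multinom m (widen_ord (leqnSn n) i) | i < n].
have := congr1 (fun Q : {poly {mpoly K[n]}} => (Q`_(m ord_max))@_(rs m)) Pz.
rewrite coef0 mcoeff0 muniE coef_sum raddf_sum /=.
have E m' : ((P@_m' *: 'X_[rs m'] *: 'X^(m' ord_max))`_(m ord_max))@_(rs m) =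
    P@_m' *+ (m' == m).
  rewrite coefZ coefXn -scalerAl mcoeffZ -[RHS]mulr_natr; congr (_ * _).
  have [->|ne] := eqVneq m' m; first by rewrite eqxx mulr1 mcoeffX eqxx.
  have [mm|_] := eqVneq (m ord_max) (m' ord_max); last by rewrite mulr0 mcoeff0.
  rewrite mulr1 mcoeffX; case: eqVneq => // rr.
  case/eqP: ne; apply/mnmP => i; case: (unliftP ord_max i) => [j|] ->; last by [].
  have := congr1 (fun w : 'X_{1..n} => w j) rr; rewrite !mnmE.
  suff -> : widen_ord (leqnSn n) j = lift ord_max j by [].
  by apply: val_inj; rewrite /= /bump leqNgt ltn_ord.
rewrite (eq_bigr _ (fun m' _ => E m')).
have [mP|mP] := boolP (m \in msupp P); last by rewrite memN_msupp_eq0.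
rewrite (bigD1_seq m) ?msupp_uniq //= eqxx mulr1n big1 ?addr0 // => m' ne.
by rewrite (negbTE ne) mulr0n.
Qed.

(* A relation over Z_(d+1) is divided by the largest possible power of the last
   function, then restricted to Z_d, where that function vanishes. *)
Lemma separated_chain_independent V (Z : nat -> set V) (f : nat -> V -> K) d :
  (forall i, (i <= d)%N -> irreducible (Z i)) ->
  (forall i, (i < d)%N -> [/\ Z i `<=` Z i.+1, polyf (f i),
     (forall x, Z i x -> f i x = 0) & exists2 x, Z i.+1 x & f i x != 0]) ->
  forall P : {mpoly K[d]},
    (forall x, Z d x -> P.@[fun i : 'I_d => f i x] = 0) -> P = 0.
Proof.
elim: d => [|d IHd] Zi Zf P P0.
  have [[x Zx] _] := Zi 0%N (leqnn _).
  have := P0 x Zx; rewrite [P](msize1_polyC (n := 0)) ?mevalC.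
    by move=> ->.
  rewrite msizeE; apply/bigmax_leqP_seq => m _ _.
  by rewrite mdegE big_ord0.
have {}IHd := IHd (fun i id => Zi i (leqW id)) (fun i id => Zf i (leqW id)).
have [Zle fp f0 [x0 Zx0 fx0]] := Zf d (ltnSn d).
suff : muni P = 0.
  exact: muni_inj.
have [k [Q Qr PE]] := multiplicity_XsubC (muni P) 0.
apply/eqP; apply: contraT => muni0; rewrite muni0 /= in Qr.
pose E (R : {poly {mpoly K[d]}}) x :=
  (map_poly (meval (fun i : 'I_d => f i x)) R).[f d x].
have Ep R : polyf (E R).
  have szR x : (size (map_poly (meval (fun i : 'I_d => f i x)) R) <= size R)%N.
    by rewrite map_polyE (leq_trans (size_Poly _)) ?size_map.
  have EE x : E R x =
      \sum_(i < size R) (R`_i).@[fun i : 'I_d => f i x] * f d x ^+ i.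
    rewrite /E (horner_coef_wide _ (szR x)).
    by apply: eq_bigr => i _; rewrite coef_map.
  rewrite (funext EE); apply: polyf_sum => i _.
  apply: polyfM; last exact: polyfX.
  by apply: polyf_meval => j; case: (Zf j (leqW (ltn_ord j))).
(* [f d] is not identically zero on [Z d.+1], so irreducibility allows its power to be cancelled
   there. *)
have QE : forall x, Z d.+1 x -> E Q x = 0.
  have [x Zx||//] := irreducible_prime (Zi d.+1 (leqnn _)) (polyfX k fp) (Ep Q).
    have := P0 x Zx; rewrite meval_muni /= PE rmorphM rmorphXn /= map_polyXsubC.
    by rewrite rmorph0 subr0 hornerM hornerXn mulrC => <-; rewrite /E.
  by move=> /(_ x0 Zx0) /eqP; rewrite expf_eq0 (negbTE fx0) andbF.
case/negP: Qr; rewrite /root horner_coef0; apply/eqP/IHd => x Zx.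
have := QE x (Zle x Zx); rewrite /E f0 // horner_coef0 coef_map /=.
by [].
Qed.

(** The third hypothesis says that the closure of the image of [F] contains [X]. It carries an
    algebraic relation between pulled-back functions over to all of [X], even where the image misses
    points. *)
Lemma irreducible_chain_leq T V (X : set V) (h : T -> K) (F : T -> V) :
  polyf h -> ratmap h F ->
  (forall f : V -> K, polyf f -> (forall t, h t != 0 -> f (F t) = 0) ->
    forall x, X x -> f x = 0) ->
  forall e, irreducible_chain X e -> (e <= \dim {:T})%N.
Proof.
move=> hp Fr dense e [Z [Zi Zlt]].
have sep i : exists f : V -> K, (i < e)%N ->
   [/\ Z i `<=` Z i.+1, polyf f,
     (forall x, Z i x -> f x = 0) & exists2 x, Z i.+1 x & f x != 0].
  (* Choice ranges over all indices; past the end of the chain a dummy function is supplied. *)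
  have [lt_ie|] := ltnP i e; last by exists (fun=> 0).
  have [Zle nle] := Zlt i lt_ie.
  have [[F0 [S ->] ZE] _] := Zi i (ltnW lt_ie).
  have [[F1 _ ZE1] _] := Zi i.+1 lt_ie.
  move: nle => /existsNP[x /not_implyP[Zx nZx]].
  have [p Sp px] : exists2 p, S p & polyfun p x != 0.
    apply: contrapT => nex; apply: nZx; rewrite ZE; split.
      by move: Zx; rewrite ZE1 => -[].
    move=> p Sp; apply: contrapT => /eqP px; apply: nex; by exists p.
  exists (polyfun p); split=> //; first exact: polyf_polyfun.
    by move=> y; rewrite ZE => -[_]; apply.
  by exists x.
have [f fE] := choice sep.
rewrite leqNgt; apply/negP => ne.
have fr (i : 'I_e) : ratf h (fun t => f i (F t)).
  by apply: ratf_comp Fr => //; case: (fE i (ltn_ord i)).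
have [P Pn0 P0] := algebraic_relation hp ne fr.
case/eqP: Pn0; apply: (@separated_chain_independent V Z f e) => [i ile|//|x Zx].
  by have [] := Zi i ile.
pose g x := P.@[fun i : 'I_e => f i x].
have gp : polyf g.
  by apply: polyf_meval => j; case: (fE j (ltn_ord j)).
apply: (dense g gp P0).
by have [[F0 _ ZE] _] := Zi e (leqnn _); move: Zx; rewrite ZE => -[].
Qed.

End Chains.

(** * Slices for the conjugation action *)

(* Covers conjugation of a single matrix and simultaneous conjugation of triples. *)
Record mx_bimodule (K : fieldType) (n : nat) (V : vectType K) := MxBimodule {
  lm : 'M[K]_n -> V -> V;
  rm : V -> 'M[K]_n -> V;
  lm_linearl : forall x, linear (lm^~ x);
  lm_linearr : forall A, linear (lm A);
  rm_linearl : forall A, linear (rm^~ A);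
  rm_linearr : forall x, linear (rm x);
  lm1 : forall x, lm 1%:M x = x;
  rm1 : forall x, rm x 1%:M = x;
  lmM : forall A B x, lm (A *m B) x = lm A (lm B x);
  rmM : forall A B x, rm x (A *m B) = rm (rm x A) B;
  lm_rm : forall A B x, lm A (rm x B) = rm (lm A x) B
}.

Section Conjugation.
Variables (K : fieldType) (n : nat) (V : vectType K).
Variable B : mx_bimodule n V.
Notation lm := (lm B).
Notation rm := (rm B).

HB.instance Definition _ A :=
  GRing.isLinear.Build K V V _ (lm A) (lm_linearr B A).
HB.instance Definition _ x :=
  GRing.isLinear.Build K 'M[K]_n V _ (rm x) (rm_linearr B x).

Definition mxconj g x := lm g (rm x (invmx g)).

Definition conj_orbit x : set V := [set mxconj g x | g in [set g | g \in unitmx]].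

(** Without the inverse the equation is linear in [g], so that [g] can be recovered from [x] and [y]
    by linear algebra. *)
Lemma mxconjE g x y : g \in unitmx -> (y = mxconj g x) <-> (rm y g = lm g x).
Proof.
move=> gu; split=> [->|E].
  by rewrite /mxconj lm_rm -rmM mulVmx // rm1.
by rewrite /mxconj lm_rm -E -rmM mulmxV // rm1.
Qed.

Lemma mxconj_centralizer g c x : g \in unitmx -> c \in unitmx ->
  lm c x = rm x c -> mxconj (g *m c) x = mxconj g x.
Proof.
move=> gu cu cx; apply/esym/(mxconjE _ _ (_ : g *m c \in unitmx)).
  by rewrite unitmx_mul gu.
by rewrite rmM ((mxconjE _ _ gu).1 erefl) lmM cx lm_rm.
Qed.

Lemma ratmap_mxconj (T : vectType K) (F : T -> 'M[K]_n) (G : T -> V) h :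
  polyf h -> (forall t, h t != 0 -> \det (F t) != 0) ->
  (forall i j, polyf (fun t => F t i j)) -> ratmap h G ->
  ratf h (fun t => (\det (F t))^-1) ->
  ratmap h (fun t => mxconj (F t) (G t)).
Proof.
move=> hp hF Fp Gr dr.
have Fr : ratmap h F by apply: ratmap_mx => // i j; apply: polyf_ratf.
have Vr : ratmap h (fun t => invmx (F t)).
  apply: ratmap_mx => // i j.
  apply: (@eq_ratf_in _ _ _ (fun t => (\det (F t))^-1 * (\adj (F t)) i j)).
    by move=> t ht; rewrite /invmx unitmxE unitfE hF // [RHS]mxE.
  apply: (ratfM dr).
  by apply: polyf_ratf; apply: polyf_adj.
have Rr : ratmap h (fun t => rm (G t) (invmx (F t))).
  exact: (ratmap_bilinear hp (rm_linearl B) (rm_linearr B)).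
exact: (ratmap_bilinear hp (lm_linearl B) (lm_linearr B)).
Qed.

End Conjugation.

(** * The slice transverse to a centralizer *)

Section Slice.
Variables (K : numFieldType) (n : nat).
Implicit Types Z : {vspace 'M[K]_n}.

Definition compl_comb Z (t : 'rV[K]_(\dim Z^C)) : 'M[K]_n :=
  \sum_i t 0 i *: (vbasis Z^C)`_i.

Fact compl_comb_linear Z : linear (@compl_comb Z).
Proof.
move=> a x y; rewrite /compl_comb scaler_sumr -big_split /=.
by apply: eq_bigr => i _; rewrite !mxE scalerDl scalerA.
Qed.

HB.instance Definition _ Z :=
  GRing.isLinear.Build K 'rV[K]_(\dim Z^C) 'M[K]_n _ (@compl_comb Z)
    (@compl_comb_linear Z).

Definition slice Z (t : 'rV[K]_(\dim Z^C)) : 'M[K]_n :=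
  1%:M + compl_comb t.

Arguments slice Z t : clear implicits.

Lemma slice0 Z : slice Z 0 = 1%:M.
Proof. by rewrite /slice linear0 addr0. Qed.

Lemma polyf_slice Z i j : polyf (fun t => slice Z t i j).
Proof.
rewrite /slice; under eq_fun do rewrite mxE.
apply: polyfD; first exact: polyf_cst.
by apply: polyf_linear => a x y; rewrite linearP !mxE.
Qed.

Lemma sliceP Z A : A - 1%:M \in (Z^C)%VS -> exists t, A = slice Z t.
Proof.
move=> AW; exists (\row_i coord (vbasis Z^C) i (A - 1%:M)).
rewrite /slice /compl_comb; under eq_bigr do rewrite mxE.
by rewrite -coord_vbasis // addrC subrK.
Qed.

(* For c in Z, the condition g c \in 1 + Z^C is a square linear system in c, which
   is nonsingular at g = 1. *)
Lemma generic_slice Z : 1%:M \in Z -> exists delta : 'M[K]_n -> K,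
  [/\ polyf delta, delta 1%:M != 0 &
    forall g, delta g != 0 -> exists c t,
      [/\ c \in Z, c \in unitmx & g *m c = slice Z t]].
Proof.
move=> Z1; set W := (Z^C)%VS; set k := \dim Z.
pose pZ := daddv_pi Z W; pose z := vbasis Z.
have ZW : (Z :&: W = 0)%VS by rewrite /W capv_compl.
pose Delta (g : 'M[K]_n) := \matrix_(i < k, j < k) coord z j (pZ (g *m z`_i)).
pose o : 'rV[K]_k := \row_j coord z j 1%:M.
(* Cramer's rule without division: [ct g] is [\det (Delta g)] times the solution c in Z of pZ (g c)
   = 1. *)
pose ct g := \sum_i (o *m \adj (Delta g)) 0 i *: z`_i.
have oE : \sum_i o 0 i *: z`_i = 1%:M.
  by rewrite [RHS](coord_vbasis Z1); apply: eq_bigr => i _; rewrite mxE.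
have Dp i j : polyf (fun g => Delta g i j).
  by apply: polyf_linear => a x y; rewrite !mxE mulmxDl -scalemxAl !linearP.
have Ap i j : polyf (fun g => (\adj (Delta g)) i j) by apply: polyf_adj.
have cp i j : polyf (fun g => ct g i j).
  rewrite /ct; under eq_fun do rewrite summxE.
  apply: polyf_sum => l _; under eq_fun do rewrite mxE.
  apply: polyfM; last exact: polyf_cst.
  under eq_fun do rewrite mxE.
  by apply: polyf_sum => m _; apply: polyfM; first exact: polyf_cst.
have pct g : pZ (g *m ct g) = \det (Delta g) *: 1%:M.
  rewrite /ct mulmx_sumr linear_sum.
  transitivity (\sum_i ((o *m \adj (Delta g)) *m Delta g) 0 i *: z`_i).
    rewrite (eq_bigr (fun i => \sum_j ((o *m \adj (Delta g)) 0 i * Delta g i j)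
        *: z`_j)); last first.
      move=> i _; rewrite -scalemxAr linearZ /=.
      rewrite {1}(coord_vbasis (memv_pi _ _ _ : pZ (g *m z`_i) \in Z)).
      rewrite scaler_sumr; apply: eq_bigr => j _.
      by rewrite [Delta g i j]mxE scalerA.
    rewrite exchange_big; apply: eq_bigr => j _ /=.
    by rewrite -scaler_suml [in RHS]mxE.
  rewrite -mulmxA mul_adj_mx mul_mx_scalar -oE scaler_sumr.
  by apply: eq_bigr => i _; rewrite mxE scalerA.
(* The first factor makes the system solvable, the second makes its solution invertible. *)
exists (fun g => \det (Delta g) * \det (ct g)); split.
- by apply: polyfM; apply: polyf_det.
- have D1 : Delta 1%:M = 1%:M.
    apply/matrixP => i j; rewrite !mxE mul1mx daddv_pi_id //.
      by rewrite coord_free ?(basis_free (vbasisP Z)) // eq_sym.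
    by rewrite vbasis_mem // mem_nth // size_tuple.
  by rewrite /ct D1 det1 mul1r adj1 mulmx1 oE det1 oner_neq0.
move=> g; rewrite mulf_eq0 negb_or => /andP[Dg cg].
have cZ : ct g \in Z.
  apply: memv_suml => i _; apply: memvZ.
  by rewrite vbasis_mem // mem_nth // size_tuple.
pose c := (\det (Delta g))^-1 *: ct g.
have : g *m c - 1%:M \in W.
  have E : pZ (g *m c) = 1%:M.
    by rewrite -scalemxAr linearZ /= pct scalerA mulVf // scale1r.
  have := @daddv_pi_add _ _ Z W (g *m c) ZW.
  rewrite /W addv_complf memvf -/W -/pZ E => /(_ isT) <-.
  by rewrite addrC addKr memv_pi.
case/sliceP => t tE; exists c, t; split=> //; first exact: memvZ.
by rewrite unitmxE detZ unitfE mulf_neq0 // expf_neq0 // invr_neq0.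
Qed.

Section Inverse.
Variables (V : vectType K) (B : mx_bimodule n V) (m0 : V) (Z : {vspace 'M[K]_n}).
Notation lm := (lm B).
Notation rm := (rm B).
Hypothesis cent : forall N, lm N m0 = rm m0 N -> N \in Z.

(* N is recovered from x = (1 + N) m0 (1 + N)^-1 by solving the linear system
   N m0 - x N = x - m0, which is nonsingular on Z^C at x = m0. *)
Lemma slice_inverse :
  exists (r : 'I_(\dim Z^C) -> V -> K) (theta : V -> K),
  [/\ forall i, polyf (r i), polyf theta, theta m0 != 0 &
    forall t i, slice Z t \in unitmx ->
     r i (mxconj B (slice Z t) m0) = t 0 i * theta (mxconj B (slice Z t) m0)].
Proof.
set W := (Z^C)%VS; set d := \dim W.
pose w := vbasis W.
have WZ : (W :&: Z = 0)%VS by rewrite capvC /W capv_compl.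
pose f0 := (fun N => lm N m0 - rm m0 N).
have f0l : linear f0 by move=> a x y; rewrite /f0 lm_linearl linearP /= scalerBr opprD addrACA.
pose f0L := GRing.isLinear.Build _ _ _ _ f0 f0l.
pose f0LL : {linear 'M[K]_n -> V} := HB.pack f0 f0L.
pose f := linfun f0LL.
have fE N : f N = lm N m0 - rm m0 N by rewrite /f lfunE.
pose pW := daddv_pi W Z.
have pW0 v : v \in Z -> pW v = 0.
  move=> vZ; have := @daddv_pi_add _ _ W Z v WZ.
  rewrite addvC /W addv_complf memvf -/W -/pW => /(_ isT).
  rewrite (@daddv_pi_id _ _ Z W v) ?[(Z :&: W)%VS]capvC // => /eqP.
  by rewrite -subr_eq0 addrK => /eqP.
(* The kernel of [f] lies in Z, so the W-component of a preimage does not depend on the preimage: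
   [L] is a linear left inverse of [f] on W. *)
pose L v j := coord w j (pW ((f^-1)%VF v)).
have Lf (i j : 'I_d) : L (f w`_i) j = (i == j)%:R.
  rewrite /L; set u := (f^-1)%VF _.
  have fu : f u = f w`_i by rewrite /u limg_lfunVK // memv_img ?memvf.
  have -> : u = w`_i + (u - w`_i) by rewrite addrC subrK.
  have uZ : u - w`_i \in Z.
    by apply: cent; apply/eqP; rewrite -subr_eq0 -fE linearB /= fu subrr.
  rewrite linearD /= (pW0 _ uZ) addr0 daddv_pi_id //.
    by rewrite coord_free ?(basis_free (vbasisP W)) // eq_sym.
  by rewrite vbasis_mem // mem_nth // size_tuple.
(* Applying [L] cuts the system down to a square one, whatever the dimension of V. Its determinant
   will be [theta], and the Cramer numerators the functions [r i]. *)
pose Theta x := \matrix_(i < d, j < d) L (lm w`_i m0 - rm x w`_i) j.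
pose rho x := \row_(j < d) L (x - m0) j.
have Ll j a x y : L (a *: x + y) j = a * L x j + L y j by rewrite /L !linearP.
have LB j x y : L (x - y) j = L x j - L y j by rewrite /L !linearB.
have Lp j : polyf (L^~ j) by apply: polyf_linear.
have Tp i j : polyf (fun x => Theta x i j).
  under eq_fun do rewrite mxE LB.
  apply: polyfD; first exact: polyf_cst.
  apply: polyf_linear => a x y.
  by rewrite rm_linearl Ll opprD mulrN.
have rp i j : polyf (fun x => rho x i j).
  under eq_fun do rewrite mxE LB.
  by apply: polyfD; [exact: Lp | exact: polyf_cst].
exists (fun i x => (rho x *m \adj (Theta x)) 0 i), (fun x => \det (Theta x)).
split.
- move=> i; under eq_fun do rewrite mxE.
  by apply: polyf_sum => j _; apply: polyfM => //; apply: polyf_adj.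
- exact: polyf_det.
- suff -> : Theta m0 = 1%:M by rewrite det1 oner_neq0.
  by apply/matrixP => i j; rewrite !mxE -fE Lf.
move=> t i gu; set x := mxconj _ _ _.
have xg : rm x (slice Z t) = lm (slice Z t) m0 by apply/(mxconjE _ _ _ gu).
have -> : rho x = t *m Theta x.
  apply/rowP => j; rewrite !mxE.
  have -> : x - m0 = \sum_i t 0 i *: (lm w`_i m0 - rm x w`_i).
    have f1l : linear (fun N => lm N m0 - rm x N).
      by move=> a u v; rewrite lm_linearl linearP /= scalerBr opprD addrACA.
    pose f1L := GRing.isLinear.Build _ _ _ _ _ f1l.
    pose f1 : {linear 'M[K]_n -> V} := HB.pack (fun N => lm N m0 - rm x N) f1L.
    rewrite -[RHS]/(\sum_i t 0 i *: f1 w`_i).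
    transitivity (f1 (compl_comb t)); last first.
      by rewrite linear_sum; apply: eq_bigr => l _; rewrite linearZ.
    have := linearD f1 1%:M (compl_comb t).
    rewrite -/(slice Z t) /= xg subrr lm1 rm1 => /esym/eqP.
    by rewrite addr_eq0 => /eqP E; rewrite -[RHS]opprK -E opprB.
  rewrite /L linear_sum linear_sum linear_sum; apply: eq_bigr => l _.
  by rewrite !linearZ /= mxE.
by rewrite -mulmxA mul_mx_adj mul_mx_scalar mxE mulrC.
Qed.

End Inverse.
End Slice.

Arguments slice {K n} Z t.

(** * Dimension of orbits and of families of orbits *)

Section OrbitDimension.
Variables (K : numFieldType) (n : nat) (V : vectType K) (B : mx_bimodule n V).
Implicit Type Z : {vspace 'M[K]_n}.

Lemma mxconj1 x : mxconj B 1%:M x = x.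
Proof. by apply/esym/mxconjE; rewrite ?unitmx1 // lm1 rm1. Qed.

(** [C i] is swept out by the slice parameters supported on the first i coordinates. The numerator
    of the next coordinate, given by the inverse of the slice, vanishes on [C i] but not on
    [C i.+1]. *)
Lemma orbit_cells Z m0 :
  (forall N, lm B N m0 = rm B m0 N -> N \in Z) ->
  exists C : nat -> set V,
  (forall i, irreducible (C i) /\ C i `<=` conj_orbit B m0) /\
  (forall i, (i < \dim Z^C)%N -> C i `<=` C i.+1 /\ separated (C i) (C i.+1)).
Proof.
move=> cent; set d := \dim Z^C.
have [r [theta [rp thp th0 rE]]] := slice_inverse cent.
(* Truncating by a matrix keeps one parameter space for all the cells. *)
pose D i : 'M[K]_d := diag_mx (\row_j (j < i)%N%:R).
have tDE (t : 'rV_d) i j : (t *m D i) 0 j = t 0 j * (j < i)%N%:R.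
  by rewrite mul_mx_diag !mxE.
pose h i t := \det (slice Z (t *m D i)).
pose psi i t := mxconj B (slice Z (t *m D i)) m0.
have Dp i : polymap (fun t : 'rV[K]_d => t *m D i).
  by apply: polymap_linear => c x y; rewrite mulmxDl scalemxAl.
have sp i k l : polyf (fun t => slice Z (t *m D i) k l).
  exact: (polyf_comp (polyf_slice Z k l) (Dp i)).
have hp i : polyf (h i).
  exact: polyf_det.
have psir i : ratmap (h i) (psi i).
  apply: ratmap_mxconj => //.
  - by move=> j; apply: ratf_cst.
  - exact: ratfV.
have h0 i : h i 0 = 1 by rewrite /h mul0mx slice0 det1.
exists (fun i => [set psi i t | t in [set t | h i t != 0]]); split=> i.
  split; first by apply: irreducible_image => //; exists 0; rewrite h0 oner_neq0.
  by move=> _ [t ht <-]; exists (slice Z (t *m D i)); rewrite //= unitmxE unitfE.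
move=> lt_id; have DD (t : 'rV_d) : t *m D i *m D i.+1 = t *m D i.
  apply/rowP => j; rewrite !tDE -mulrA -natrM; congr (_ * _%:R).
  by case: (ltnP j i) => // ji; rewrite mul1n ltnS ltnW.
split.
  by move=> _ [t ht <-]; exists (t *m D i); rewrite /= /psi /h DD.
pose i' := Ordinal lt_id.
exists (r i'); split=> //.
  move=> _ [t ht <-]; rewrite /psi rE ?unitmxE ?unitfE //.
  by rewrite tDE ltnn mulr0 mul0r.
have [N [P [Pp PE]]] := ratf_comp (hp i.+1) thp (psir i.+1).
(* At parameter 0 the orbit point is [m0], where [theta] does not vanish; hence [theta] is nonzero
   at a generic parameter too. *)
have P0 : P 0 != 0.
  by rewrite -PE h0 ?oner_neq0 // expr1n mulr1 /psi mul0mx slice0 mxconj1.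
have ti : polyf (fun t : 'rV[K]_d => t 0 i').
  by apply: polyf_linear => a x y; rewrite !mxE.
have [t /andP[tn Pn]] : exists t : 'rV[K]_d, (t 0 i' != 0) && (P t * h i.+1 t != 0).
  apply: polyf_neq0M => //; first exact: polyfM.
    by exists (delta_mx 0 i'); rewrite mxE !eqxx oner_neq0.
  by exists 0; rewrite h0 mulr1.
move: Pn; rewrite mulf_eq0 negb_or => /andP[Pt ht].
exists (psi i.+1 t); first by exists t.
rewrite /psi rE ?unitmxE ?unitfE // tDE ltnSn mulr1 mulf_neq0 //.
by apply: contraNneq Pt; rewrite -PE // /psi => ->; rewrite mul0r.
Qed.

Definition conj_family r (m : 'rV[K]_r -> V) (q : 'rV[K]_r -> K) : set V :=
  [set x | exists g s, [/\ g \in unitmx, q s != 0 & x = mxconj B g (m s)]].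

Section Family.
Variables (r : nat) (m : 'rV[K]_r -> V) (q : 'rV[K]_r -> K).
Hypotheses (mp : polymap m) (qp : polyf q).

Lemma irreducible_family : (exists s, q s != 0) -> irreducible (conj_family m q).
Proof.
move=> [s0 qs0]; pose T := ('M[K]_n * 'rV[K]_r)%type.
have p1 i j : polyf (fun t : T => t.1 i j).
  by apply: polyf_linear => a x y; rewrite /= !mxE.
have p2 : polymap (fun t : T => t.2).
  by move=> i; apply/polyf_ratf/polyf_linear => a x y; rewrite /= linearP.
pose h (t : T) := \det t.1 * q t.2.
have hp : polyf h by apply: polyfM; [exact: polyf_det | exact: polyf_comp].
have -> : conj_family m q = [set mxconj B t.1 (m t.2) | t in [set t : T | h t != 0]].
  apply/seteqP; split=> x /=.
    case=> g [s [gu qs ->]]; exists (g, s) => //=.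
    by rewrite /h mulf_neq0 // -unitfE -unitmxE.
  case=> -[g s] /=; rewrite /h mulf_eq0 negb_or => /andP[dg qs] <-.
  by exists g, s; rewrite unitmxE unitfE.
apply: irreducible_image => //.
  by exists (1%:M, s0); rewrite /h /= det1 mul1r.
apply: ratmap_mxconj => //.
- by move=> t; rewrite /h mulf_eq0 negb_or => /andP[].
- exact: (ratmap_comp hp mp (polymap_ratmap _ p2)).
- apply: (@eq_ratf_in _ _ _ (fun t => (h t)^-1 * q t.2)).
    move=> t; rewrite /h mulf_eq0 negb_or => /andP[_ qt].
    by rewrite invfM -mulrA mulVf // mulr1.
  by apply: ratfM; [exact: ratfV | apply: polyf_ratf; apply: polyf_comp].
Qed.

(** Slice and parameter together give a map with dense image. Multiplying g on the right by a unit
    of Z leaves the conjugate of [m s] unchanged and brings a generic g into the slice; a function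
    that vanishes on the slice points therefore vanishes for generic g, hence for all g. *)
Lemma family_chain_leq Z e :
  1%:M \in Z -> (forall s c, c \in Z -> lm B c (m s) = rm B (m s) c) ->
  irreducible_chain (conj_family m q) e -> (e <= \dim Z^C + r)%N.
Proof.
move=> Z1 Zc; set d := \dim Z^C; pose T := ('rV[K]_d * 'rV[K]_r)%type.
have p1 i j : polyf (fun t : T => slice Z t.1 i j).
  apply: (polyf_comp (f := fun t => slice Z t i j) (polyf_slice _ _ _)).
  by move=> k; apply/polyf_ratf/polyf_linear => a x y; rewrite /= linearP.
have p2 : polymap (fun t : T => t.2).
  by move=> i; apply/polyf_ratf/polyf_linear => a x y; rewrite /= linearP.
pose h (t : T) := \det (slice Z t.1) * q t.2.
have hp : polyf h by apply: polyfM; [exact: polyf_det | exact: polyf_comp].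
have Fr : ratmap h (fun t => mxconj B (slice Z t.1) (m t.2)).
  apply: ratmap_mxconj => //.
  - by move=> t; rewrite /h mulf_eq0 negb_or => /andP[].
  - exact: (ratmap_comp hp mp (polymap_ratmap _ p2)).
  - apply: (@eq_ratf_in _ _ _ (fun t => (h t)^-1 * q t.2)).
      move=> t; rewrite /h mulf_eq0 negb_or => /andP[_ qt].
      by rewrite invfM -mulrA mulVf // mulr1.
    by apply: ratfM; [exact: ratfV | apply: polyf_ratf; apply: polyf_comp].
move=> ch; suff : (e <= \dim {:T})%N.
  rewrite dimvf; have -> : dim T = (dim 'rV[K]_d + dim 'rV[K]_r)%N by [].
  rewrite !dim_matrix -[X in (_ <= X)%N -> _]/(1 * d + 1 * r)%N.
  by rewrite !mul1n.
apply: (irreducible_chain_leq hp Fr _ ch) => f fp f0 _ [g0 [s [g0u qs ->]]].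
have [delta [dp d1 dE]] := generic_slice Z1.
have detp : polyf (fun g : 'M[K]_n => \det g).
  by apply: polyf_det => i j; apply: polyf_linear => a x y; rewrite !mxE.
have : ratf (fun g : 'M[K]_n => \det g) (fun g => f (mxconj B g (m s))).
  apply: ratf_comp => //; apply: ratmap_mxconj => //.
  - by move=> i j; apply: polyf_linear => a x y; rewrite !mxE.
  - by move=> i; apply: ratf_cst.
  - exact: ratfV.
case=> N [P [Pp PE]].
have P0 : P g0 = 0.
  apply/eqP; apply: contraT => Pg0.
  have [g /andP[Pg]] : exists g, (P g != 0) && (delta g * \det g != 0).
    apply: polyf_neq0M => //; first exact: polyfM; first by exists g0.
    by exists 1%:M; rewrite det1 mulr1.
  rewrite mulf_eq0 negb_or => /andP[dg gu].
  have [c [t [cZ cu gc]]] := dE g dg.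
  case/eqP: Pg; rewrite -PE // -(mxconj_centralizer _ cu (Zc s c cZ)); last first.
    by rewrite unitmxE unitfE.
  have := f0 (t, s); rewrite /= gc => ->; first by rewrite mul0r.
  by rewrite /h /= -gc det_mulmx !mulf_neq0 // -unitfE -unitmxE.
have := PE g0; rewrite -unitfE -unitmxE P0 => /(_ g0u) /eqP.
rewrite mulf_eq0 expf_eq0 => /orP[/eqP //|/andP[_ /eqP dg0]].
by move: g0u; rewrite unitmxE dg0 unitr0.
Qed.

End Family.

Lemma dim_compl Z : \dim Z^C = (n * n - \dim Z)%N.
Proof. by rewrite dimv_compl dimvf dim_matrix. Qed.

Lemma has_dim_orbit Z m0 :
  (forall N, N \in Z <-> lm B N m0 = rm B m0 N) ->
  has_dim (conj_orbit B m0) (n * n - \dim Z).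
Proof.
move=> cent; have [C [Ci Cs]] := orbit_cells (fun N => (cent N).2).
rewrite -dim_compl; split.
  by apply: (irreducible_chain_of_separated (Z := C)) => [i _|]; [exact: Ci | exact: Cs].
(* An orbit is a family without parameters, so the bound for families applies. *)
move=> e; have -> : conj_orbit B m0 = conj_family (fun _ : 'rV[K]_0 => m0) (fun=> 1).
  apply/seteqP; split=> x /=.
    by case=> g gu <-; exists g, 0; rewrite oner_neq0.
  by case=> g [s [gu _ ->]]; exists g.
rewrite -[X in (_ <= X)%N]addn0; apply: family_chain_leq.
- by move=> i; apply: ratf_cst.
- exact: polyf_cst.
- by apply/cent; rewrite lm1 rm1.
- by move=> _ c /cent.
Qed.

(** The cells of one orbit give a chain of length [\dim Z^C], and the irreducible family is placed
    on top of it; separation makes that last inclusion strict. *)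
Lemma has_dim_family1 Z (m : 'rV[K]_1 -> V) q s0 :
  polymap m -> polyf q -> q s0 != 0 ->
  (forall s c, c \in Z -> lm B c (m s) = rm B (m s) c) ->
  (forall N, lm B N (m s0) = rm B (m s0) N -> N \in Z) ->
  separated (conj_orbit B (m s0)) (conj_family m q) ->
  has_dim (conj_family m q) (n * n - \dim Z).+1.
Proof.
move=> mp qp qs0 Zc cent sep; have [C [Ci Cs]] := orbit_cells cent.
have oX : conj_orbit B (m s0) `<=` conj_family m q.
  by move=> _ [g gu <-]; exists g, s0.
rewrite -dim_compl; split; last first.
  move=> e /(family_chain_leq mp qp) H; rewrite -addn1; apply: H => //.
  by apply: cent; rewrite lm1 rm1.
set d := \dim Z^C in Cs *.
apply: (irreducible_chain_of_separated
  (Z := fun i => if (i <= d)%N then C i else conj_family m q)) => i ile.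
  case: ifP => _; last by split=> //; apply: irreducible_family => //; exists s0.
  by have [iC CO] := Ci i; split=> // x /CO /oX.
rewrite -ltnS ile; case: ltnP => [id|di]; first exact: Cs.
have [iC CO] := Ci i; split; first by move=> x /CO /oX.
by have [f [fp f0 fn]] := sep; exists f; split=> // x /CO /f0.
Qed.

End OrbitDimension.

(** * Dual numbers and the dimension of the classes *)

Section Bimodules.
Variables (K : fieldType) (n : nat).

Definition mx_self : mx_bimodule n 'M[K]_n.
Proof.
refine (@MxBimodule K n 'M[K]_n (fun A x => A *m x) (fun x A => x *m A) _ _ _ _ _ _ _ _ _).
- by move=> x c A A'; rewrite mulmxDl scalemxAl.
- by move=> A c x y; rewrite mulmxDr scalemxAr.
- by move=> A c x y; rewrite mulmxDl scalemxAl.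
- by move=> x c A A'; rewrite mulmxDr scalemxAr.
- exact: mul1mx.
- exact: mulmx1.
- by move=> A A' x; rewrite mulmxA.
- by move=> A A' x; rewrite mulmxA.
- by move=> A A' x; rewrite mulmxA.
Defined.

Definition mx_triple : mx_bimodule n ('M[K]_n * 'M[K]_n * 'M[K]_n)%type.
Proof.
refine (@MxBimodule K n ('M[K]_n * 'M[K]_n * 'M[K]_n)%type
  (fun A x => (A *m x.1.1, A *m x.1.2, A *m x.2))
  (fun x A => (x.1.1 *m A, x.1.2 *m A, x.2 *m A)) _ _ _ _ _ _ _ _ _).
- by move=> x c A A'; rewrite !mulmxDl -!scalemxAl.
- by move=> A c x y; rewrite /= !mulmxDr -!scalemxAr.
- by move=> A c x y; rewrite /= !mulmxDl -!scalemxAl.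
- by move=> x c A A'; rewrite !mulmxDr -!scalemxAr.
- by case=> [[x y] z] /=; rewrite !mul1mx.
- by case=> [[x y] z] /=; rewrite !mulmx1.
- by move=> A A' x; rewrite /= !mulmxA.
- by move=> A A' x; rewrite /= !mulmxA.
- by move=> A A' x; rewrite /= !mulmxA.
Defined.

Lemma conj_classP (J M : 'M[K]_n) :
  conj_class J M <-> exists2 P, P \in unitmx & P *m M = J *m P.
Proof.
split=> -[P Pu PM]; exists P => //; first exact/similarP.
by apply/similarP.
Qed.

Lemma conj_class_orbit (J : 'M[K]_n) : conj_class J = conj_orbit mx_self J.
Proof.
apply/seteqP; split=> M.
  case/conj_classP => P Pu PM; exists (invmx P); rewrite /= ?unitmx_inv //.
  by rewrite /mxconj /= invmxK -PM mulKmx.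
case=> g /= gu <-; apply/conj_classP; exists (invmx g); rewrite ?unitmx_inv //.
by rewrite /mxconj /= mulKmx.
Qed.

End Bimodules.

Section CentralizerDimension.
Variables (K : fieldType) (n : nat) (U : vectType K) (E : {linear U -> 'M[K]_n}).
Hypothesis Einj : forall x, E x = 0 -> x = 0.

Lemma dim_limg_inj : \dim (limg (linfun E)) = \dim {:U}.
Proof.
rewrite limg_dim_eq //; apply/eqP; rewrite -subv0; apply/subvP => x.
rewrite memv_cap memv_ker lfunE /= => /andP[_ /eqP /Einj ->].
exact: mem0v.
Qed.

Lemma mem_limg_linfun N : N \in limg (linfun E) <-> exists u, N = E u.
Proof.
split=> [/memv_imgP[u _ ->]|[u ->]]; first by exists u; rewrite lfunE.
by rewrite -[E u]lfunE memv_img ?memvf.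
Qed.

End CentralizerDimension.

(** [E] parametrizes the centralizer of [J] injectively, so the source of [E] has its dimension. *)
Lemma has_dim_conj_class (K : numFieldType) n (U : vectType K)
    (E : {linear U -> 'M[K]_n}) (J : 'M[K]_n) :
  (forall x, E x = 0 -> x = 0) ->
  (forall N, N *m J = J *m N <-> exists u, N = E u) ->
  has_dim (conj_class J) (n * n - \dim {:U}).
Proof.
move=> Einj cent; rewrite -(dim_limg_inj Einj) conj_class_orbit.
apply: has_dim_orbit => N; rewrite /= cent; exact: mem_limg_linfun.
Qed.

(** * Dual numbers as 2 x 2 matrices *)

Section TwoByTwo.
Variable K : fieldType.
Implicit Types (x y c : K) (A B N : 'M[K]_2).

(* The dual number x + y nu, nu^2 = 0. *)
Definition jmx x y : 'M[K]_2 :=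
  \matrix_(i, j) (if i == j then x else if (i.+1 == j)%N then y else 0).

Lemma mx2P A B : A 0 0 = B 0 0 -> A 0 1 = B 0 1 -> A 1 0 = B 1 0 ->
  A 1 1 = B 1 1 -> A = B.
Proof.
move=> e00 e01 e10 e11; apply/matrixP => i j.
have ord2 (k : 'I_2) : k = 0 \/ k = 1.
  by case: k => -[|[|]] // ?; [left | right]; apply: val_inj.
by case: (ord2 i) => ->; case: (ord2 j) => ->.
Qed.

Lemma mulmx2E m p (A : 'M[K]_(m, 2)) (B : 'M[K]_(2, p)) i j :
  (A *m B) i j = A i 0 * B 0 j + A i 1 * B 1 j.
Proof.
rewrite mxE !big_ord_recl big_ord0 addr0; congr (_ * _ + A _ _ * B _ _);
  exact: val_inj.
Qed.

Lemma trmx2E A : \tr A = A 0 0 + A 1 1.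
Proof.
rewrite /mxtrace !big_ord_recl big_ord0 addr0; congr (_ + A _ _); exact: val_inj.
Qed.

Lemma detmx2E A : \det A = A 0 0 * A 1 1 - A 0 1 * A 1 0.
Proof.
rewrite (expand_det_row _ 0) !big_ord_recl big_ord0 addr0 /cofactor !det_mx11 !mxE.
rewrite /= !add0n expr0 expr1 mul1r mulN1r mulrN; congr (_ * A _ _ - A _ _ * A _ _);
  exact: val_inj.
Qed.

Lemma Cayley_Hamilton2 A : A *m A = \tr A *: A - (\det A)%:M.
Proof.
by rewrite detmx2E trmx2E; apply: mx2P; rewrite mulmx2E !mxE /= ?mulr1n ?mulr0n; ring.
Qed.

Lemma jmxE00 x y : jmx x y 0 0 = x. Proof. by rewrite mxE. Qed.
Lemma jmxE01 x y : jmx x y 0 1 = y. Proof. by rewrite mxE. Qed.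
Lemma jmxE10 x y : jmx x y 1 0 = 0. Proof. by rewrite mxE. Qed.
Lemma jmxE11 x y : jmx x y 1 1 = x. Proof. by rewrite mxE. Qed.
Definition jmxE := (jmxE00, jmxE01, jmxE10, jmxE11).

Lemma jmxM x y x' y' : jmx x y *m jmx x' y' = jmx (x * x') (x * y' + y * x').
Proof. by apply: mx2P; rewrite mulmx2E !jmxE; ring. Qed.

Lemma jmxD x y x' y' : jmx x y + jmx x' y' = jmx (x + x') (y + y').
Proof. by apply: mx2P; rewrite [LHS]mxE !jmxE ?addr0. Qed.

Lemma jmxN x y : - jmx x y = jmx (- x) (- y).
Proof. by apply: mx2P; rewrite [LHS]mxE !jmxE ?oppr0. Qed.

Lemma jmxZ c x y : c *: jmx x y = jmx (c * x) (c * y).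
Proof. by apply: mx2P; rewrite [LHS]mxE !jmxE ?mulr0. Qed.

Lemma scalar_jmx c : c%:M = jmx c 0.
Proof. by apply: mx2P; rewrite mxE jmxE. Qed.

Lemma jmx0 : 0 = jmx 0 0.
Proof. by apply: mx2P; rewrite mxE jmxE. Qed.

Definition jmx_simp := (scalar_jmx, jmx0, jmxN, jmxZ, jmxM, jmxD).

Lemma jmx_inj x y x' y' : jmx x y = jmx x' y' -> x = x' /\ y = y'.
Proof.
move=> E; split; first by rewrite -(jmxE00 x y) E jmxE00.
by rewrite -(jmxE01 x y) E jmxE01.
Qed.

Lemma det_jmx x y : \det (jmx x y) = x ^+ 2.
Proof. by rewrite detmx2E !jmxE; ring. Qed.

Lemma jordan_pairE c : jordan_pair c = c%:M.
Proof.
rewrite /jordan_pair (_ : jordan_block _ c = c%:M) -?scalar_mx_block //.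
by apply/matrixP => i j; rewrite !mxE !ord1.
Qed.

Lemma jmx_centralizer x y N : y != 0 ->
  N *m jmx x y = jmx x y *m N -> N = jmx (N 0 0) (N 0 1).
Proof.
move=> y0 /matrixP E.
have := E 0 0; have := E 0 1; rewrite !mulmx2E !jmxE => e01 e00.
have n10 : N 1 0 = 0.
  apply: (mulfI y0); apply: (addrI (x * N 0 0)); rewrite -e00; ring.
have n11 : N 1 1 = N 0 0.
  by apply: (mulfI y0); apply: (addrI (x * N 0 1)); rewrite -e01; ring.
by apply: mx2P; rewrite jmxE.
Qed.

(** Sylvester's equation with disjoint spectra, solved from the lower left entry, the only one whose
    equation involves no other entry. *)
Lemma jmx_sylvester x y x' y' N : x != x' ->
  N *m jmx x' y' = jmx x y *m N -> N = 0.
Proof.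
move=> xx' /matrixP E; have d0 : x' - x != 0 by rewrite subr_eq0 eq_sym.
have := E 0 0; have := E 0 1; have := E 1 0; have := E 1 1.
rewrite !mulmx2E !jmxE !mul0r !add0r => e11 e10 e01 e00.
have n10 : N 1 0 = 0.
  by apply: (mulfI d0); apply: (addrI (x * N 1 0)); rewrite -[in RHS]e10; ring.
have n00 : N 0 0 = 0.
  apply: (mulfI d0); apply: (addrI (x * N 0 0 + y * N 1 0)).
  by rewrite -[in RHS]e00 n10; ring.
have n11 : N 1 1 = 0.
  apply: (mulfI d0); apply: (addrI (x * N 1 1)).
  by rewrite -[in RHS]e11 n10; ring.
have n01 : N 0 1 = 0.
  apply: (mulfI d0); apply: (addrI (x * N 0 1 + y * N 1 1)).
  by rewrite -[in RHS]e01 n11 n00; ring.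
by apply: mx2P; rewrite mxE.
Qed.

(** Row vectors model the dual numbers by a space of known dimension when centralizers are
    measured. *)
Definition jrow (v : 'rV[K]_2) := jmx (v 0 0) (v 0 1).

Fact jrow_linear : linear jrow.
Proof. by move=> c v w; rewrite /jrow !mxE jmxZ jmxD. Qed.

HB.instance Definition _ := GRing.isLinear.Build K _ _ _ jrow jrow_linear.

Lemma jrow_eq0 v : jrow v = 0 -> v = 0.
Proof.
rewrite jmx0 => /jmx_inj[v0 v1]; apply/rowP => i; rewrite mxE.
by case: i => -[|[|]] // ?; [rewrite -v0 | rewrite -v1]; congr (v _ _); apply: val_inj.
Qed.

Lemma jrowP x y : jmx x y = jrow (\row_i (if i == 0 then x else y)).
Proof. by rewrite /jrow !mxE. Qed.

Lemma block_scalar_centralizer (A B : 'M[K]_2) (N : 'M[K]_(2 + 2)) :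
  N *m block_mx A 0 0 B = block_mx A 0 0 B *m N <->
  [/\ ulsubmx N *m A = A *m ulsubmx N, ursubmx N *m B = A *m ursubmx N,
      dlsubmx N *m A = B *m dlsubmx N & drsubmx N *m B = B *m drsubmx N].
Proof.
rewrite -{1 2}[N]submxK !mulmx_block !mulmx0 !mul0mx !addr0 !add0r.
split; first by case/eq_block_mx.
by case=> -> -> -> ->.
Qed.

End TwoByTwo.

(** * Dimensions of the three classes *)

Section ClassDimensions.
Variable K : numFieldType.

(** The last two hypotheses kill the off-diagonal blocks of a commuting matrix. A Jordan block of
    size 2 then contributes 2 to the centralizer and a scalar block 4, whence 12, 10 and 8 for the
    three classes. *)
Lemma has_dim_block_diag (U1 U2 : vectType K) (E1 : {linear U1 -> 'M[K]_2})
    (E2 : {linear U2 -> 'M[K]_2}) (A B : 'M[K]_2) :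
  (forall x, E1 x = 0 -> x = 0) -> (forall x, E2 x = 0 -> x = 0) ->
  (forall N, N *m A = A *m N <-> exists x, N = E1 x) ->
  (forall N, N *m B = B *m N <-> exists x, N = E2 x) ->
  (forall N, N *m B = A *m N -> N = 0) ->
  (forall N, N *m A = B *m N -> N = 0) ->
  has_dim (@conj_class K 4 (block_mx A 0 0 B)) (16 - (\dim {:U1} + \dim {:U2})).
Proof.
move=> E1i E2i cA cB sAB sBA.
pose E (x : U1 * U2) : 'M[K]_(2 + 2) := block_mx (E1 x.1) 0 0 (E2 x.2).
have El : linear E.
  move=> c x y; rewrite /E /= !linearP scale_block_mx !scaler0 add_block_mx.
  by rewrite !addr0.
pose EL := GRing.isLinear.Build _ _ _ _ E El.
pose E' : {linear (U1 * U2)%type -> 'M[K]_(2 + 2)} := HB.pack E EL.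
have -> : (16 - (\dim {:U1} + \dim {:U2}) = 4 * 4 - \dim {:(U1 * U2)%type})%N.
  by rewrite !dimvf.
apply: (has_dim_conj_class (E := E')) => [x|N].
  rewrite /= /E -[RHS]block_mx0 => /eq_block_mx[e1 _ _ e2].
  by case: x e1 e2 => x1 x2 /= /E1i -> /E2i ->.
rewrite block_scalar_centralizer; split.
  case=> /cA[x1 N1] /sAB N2 /sBA N3 /cB[x2 N4]; exists (x1, x2).
  by rewrite /= /E /= -N1 -N4 -[LHS]submxK N2 N3.
case=> x ->; rewrite /= /E block_mxKul block_mxKur block_mxKdl block_mxKdr.
by rewrite !mul0mx !mulmx0; split=> //; [apply/cA; exists x.1 | apply/cB; exists x.2].
Qed.

Lemma jrow_cent x y (N : 'M[K]_2) : y != 0 ->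
  N *m jmx x y = jmx x y *m N <-> exists v, N = jrow v.
Proof.
move=> y0; split=> [/jmx_centralizer -> //|[v ->]].
  by exists (\row_i (if i == 0 then N 0 0 else N 0 1)); rewrite -jrowP.
by rewrite /jrow !jmxM; congr jmx; ring.
Qed.

Lemma scalar_cent c (N : 'M[K]_2) :
  N *m c%:M = c%:M *m N <-> exists M, N = idfun M.
Proof. by split=> [_|_]; [exists N | rewrite scalar_mxC]. Qed.

Lemma has_dim_class1 (a b : K) : a != b -> has_dim (class1 a b) 12.
Proof.
move=> ab.
have := @has_dim_block_diag _ _ (@jrow K) (@jrow K) (jmx a 1) (jmx b 1).
rewrite dimvf dim_matrix; apply; try exact: jrow_eq0.
- by move=> N; apply: jrow_cent; apply: oner_neq0.
- by move=> N; apply: jrow_cent; apply: oner_neq0.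
- by move=> N; apply: jmx_sylvester.
- by move=> N; apply: jmx_sylvester; rewrite eq_sym.
Qed.

Lemma has_dim_class2 (f g : K) : f != g -> has_dim (class2 f g) 10.
Proof.
move=> fg; rewrite /class2 jordan_pairE.
have := @has_dim_block_diag _ _ (@jrow K) idfun (jmx f 1) g%:M.
rewrite !dimvf !dim_matrix; apply => //.
- exact: jrow_eq0.
- by move=> N; apply: jrow_cent; apply: oner_neq0.
- exact: scalar_cent.
- by move=> N; rewrite scalar_jmx; apply: jmx_sylvester.
- by move=> N; rewrite scalar_jmx; apply: jmx_sylvester; rewrite eq_sym.
Qed.

Lemma has_dim_class3 (u v : K) : u != v -> has_dim (class3 u v) 8.
Proof.
move=> uv; rewrite /class3 !jordan_pairE.
have := @has_dim_block_diag _ _ idfun idfun u%:M v%:M.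
rewrite !dimvf !dim_matrix; apply => //.
- exact: scalar_cent.
- exact: scalar_cent.
- by move=> N; rewrite !scalar_jmx; apply: jmx_sylvester.
- by move=> N; rewrite !scalar_jmx; apply: jmx_sylvester; rewrite eq_sym.
Qed.

End ClassDimensions.

(** * Normal form of the triples *)

Section Blocks.
Variable K : fieldType.

Lemma row_ker_nunit n (Q : 'M[K]_n) : Q \notin unitmx ->
  exists2 r : 'rV_n, r != 0 & r *m Q = 0.
Proof.
rewrite -row_free_unit -kermx_eq0 => /rowV0Pn[r /sub_kermxP rQ r0].
by exists r.
Qed.

Lemma similar_tr n (P A J : 'M[K]_n) : P \in unitmx -> P *m A = J *m P ->
  \tr A = \tr J.
Proof.
move=> Pu PA; have -> : J = P *m A *m invmx P by rewrite PA mulmxK.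
by rewrite mxtrace_mulC mulmxA mulVmx // mul1mx.
Qed.

Lemma similar_det n (P A J : 'M[K]_n) : P \in unitmx -> P *m A = J *m P ->
  \det A = \det J.
Proof.
move=> Pu PA; have -> : J = P *m A *m invmx P by rewrite PA mulmxK.
by rewrite !det_mulmx mulrAC -det_mulmx mulmxV // det1 mul1r.
Qed.

Lemma similar_sub n (P A J : 'M[K]_n) c : P *m A = J *m P ->
  P *m (A - c%:M) = (J - c%:M) *m P.
Proof. by move=> PA; rewrite mulmxBr mulmxBl PA scalar_mxC. Qed.

Lemma similar_mul n (P A J A' J' : 'M[K]_n) : P *m A = J *m P ->
  P *m A' = J' *m P -> P *m (A *m A') = (J *m J') *m P.
Proof. by move=> PA PA'; rewrite mulmxA PA -!mulmxA PA'. Qed.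

Lemma similar_eq0 n (P A J : 'M[K]_n) : P \in unitmx -> P *m A = J *m P ->
  (A == 0) = (J == 0).
Proof.
move=> Pu PA; apply/eqP/eqP => E.
  by rewrite -[J](mulmxK Pu) -PA E mulmx0 mul0mx.
by rewrite -[A](mulKmx Pu) PA E mul0mx mulmx0.
Qed.

Lemma block_sub_scalar m n (A : 'M[K]_m) (X : 'M[K]_(m, n)) (Y : 'M[K]_(n, m))
    (D : 'M[K]_n) c :
  block_mx A X Y D - c%:M = block_mx (A - c%:M) X Y (D - c%:M).
Proof. by rewrite scalar_mx_block opp_block_mx add_block_mx !oppr0 !addr0. Qed.

End Blocks.

(* Up to scaling, three unipotents with product 1.  Cayley-Hamilton for ph gives the
   trace of jmx a 1 *m be, which differs from a * \tr be by the entry be 1 0. *)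
Lemma commuting_triple (K : fieldType) (a b f : K) (be ph : 'M[K]_2) :
  a != 0 -> b != 0 -> f != 0 -> \tr be = b *+ 2 -> \det be = b ^+ 2 ->
  \tr ph = f *+ 2 -> \det ph = f ^+ 2 -> ph *m jmx a 1 *m be = (a * b * f)%:M ->
  exists s, be = jmx b (b * s) /\ ph = jmx f (- f * (s + a^-1)).
Proof.
move=> a0 b0 f0 trA detA trB detB phE.
have CHph : ph *m ph = (f *+ 2) *: ph - (f ^+ 2)%:M.
  by rewrite Cayley_Hamilton2 trB detB.
have abE : f *: (jmx a 1 *m be) = (a * b * f *+ 2)%:M - (a * b) *: ph.
  apply: (scalerI f0); have : ph *m (ph *m jmx a 1 *m be) = (a * b * f) *: ph.
    by rewrite phE mul_mx_scalar.
  rewrite !mulmxA CHph !mulmxBl -!scalemxAl phE mul_scalar_mx -scalemxAl.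
  move: (jmx a 1 *m be) => M /eqP; rewrite subr_eq addrC -subr_eq => /eqP E.
  rewrite scalerA -expr2 -E; apply/matrixP => i j; rewrite !mxE.
  by case: (i == j); rewrite ?mulr1n ?mulr0n; ring.
have tr2 : \tr (jmx a 1 *m be) = a * b *+ 2.
  apply: (mulfI f0); have := congr1 mxtrace abE.
  rewrite mxtraceZ => ->; rewrite linearB /= mxtrace_scalar mxtraceZ trB.
  by ring.
have [be00 be10 be11] : [/\ be 0 0 = b, be 1 0 = 0 & be 1 1 = b].
  move: tr2 trA detA; rewrite !trmx2E detmx2E !mulmx2E !jmxE.
  move: (be 0 0) (be 0 1) (be 1 0) (be 1 1) => x y z w t1 t2 d.
  have z0 : z = 0.
    have -> : z = a * x + 1 * z + (0 * y + a * w) - a * (x + w) by ring.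
    by rewrite t1 t2; ring.
  have xb : x = b.
    apply/eqP; rewrite -subr_eq0 -sqrf_eq0; apply/eqP.
    transitivity (b ^+ 2 - x * w); last by rewrite -d z0; ring.
    have -> : w = b *+ 2 - x by rewrite -t2; ring.
    by ring.
  by split=> //; move: t2; rewrite xb mulr2n => /addrI.
have beE : be = jmx b (be 0 1).
  by apply: mx2P; rewrite jmxE.
(* [s] is the nilpotent part of be / b. As [abE] expresses [ph] through [be], the nilpotent part of
   ph / f is forced: those of the three factors, the first being 1/a, add up to zero. *)
exists (be 0 1 / b); split; first by rewrite {1}beE [b * _]mulrC divfK.
have ab0 : a * b != 0 by rewrite mulf_neq0.
apply: (scalerI ab0).
move/eqP: abE; rewrite eq_sym subr_eq addrC -subr_eq => /eqP <-.
rewrite {1}beE !jmxM !scalar_jmx !jmxZ jmxN jmxD.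
by congr jmx; field; rewrite ?a0 ?b0.
Qed.

Section Triples.
Variable K : fieldType.
Variables a b f g u v : K.
Hypotheses (a0 : a != 0) (b0 : b != 0) (f0 : f != 0)
    (g0 : g != 0) (u0 : u != 0) (v0 : v != 0)
    (ab : a != b) (fg : f != g) (uv : u != v)
    (prod1 : a * b * f * g * u * v = 1)
    (gen : relatively_generic a b f g u v).

(** The case m = 1 of genericity: the obstruction to a one-dimensional invariant subspace. *)
Lemma generic1 x y z : (x = a \/ x = b) -> (y = f \/ y = g) ->
  (z = u \/ z = v) -> x * y * z != 1.
Proof.
move=> xE yE zE; apply/eqP => E.
pose k c (w : K) := if w == c then 1%N else 0%N.
suff : [/\ 1 = 2, k a x = 1, k f y = 1 & k u z = 1]%N by case.
apply: gen => //; try by rewrite /k; case: ifP.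
have kE (c d w : K) : c != d -> (w = c \/ w = d) ->
    c ^+ k c w * d ^+ (1 - k c w) = w.
  move=> cd [->|->]; rewrite /k ?eqxx ?expr0 ?expr1 ?mulr1 //.
  by rewrite eq_sym (negbTE cd) expr0 expr1 mul1r.
transitivity ((a ^+ k a x * b ^+ (1 - k a x)) * (f ^+ k f y * g ^+ (1 - k f y))
    * (u ^+ k u z * v ^+ (1 - k u z))); first by rewrite !mulrA.
by rewrite (kE _ _ _ ab xE) (kE _ _ _ fg yE) (kE _ _ _ uv zE).
Qed.

(** In the adapted basis the coupling block is normalized to 1, and every block is a dual number. *)
Definition norm1 s : 'M[K]_(2 + 2) :=
  block_mx (jmx a 1) 0 1%:M (jmx b (b * s)).
Definition norm2 s : 'M[K]_(2 + 2) :=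
  block_mx (jmx f (- f * (s + a^-1)))
    (jmx (u^-1 + v^-1 - f * a - g * b) ((f * a - g * b) * s)) 0 g%:M.
(** The inverse of [norm1 s *m norm2 s], read off from a quadratic equation with roots u^-1 and
    v^-1. *)
Definition norm3 s : 'M[K]_(2 + 2) :=
  (u * v) *: ((u^-1 + v^-1)%:M - norm1 s *m norm2 s).

Lemma class1P (M : 'M[K]_(2 + 2)) : class1 a b M <->
  exists2 P : 'M[K]_(2 + 2), P \in unitmx &
    P *m M = block_mx (jmx a 1) 0 0 (jmx b 1) *m P.
Proof. exact: conj_classP. Qed.

Lemma class2P (M : 'M[K]_(2 + 2)) : class2 f g M <->
  exists2 P : 'M[K]_(2 + 2), P \in unitmx &
    P *m M = block_mx (jmx f 1) 0 0 g%:M *m P.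
Proof. by rewrite /class2 jordan_pairE; apply: conj_classP. Qed.

Lemma class3P (M : 'M[K]_(2 + 2)) : class3 u v M <->
  exists2 P : 'M[K]_(2 + 2), P \in unitmx &
    P *m M = block_mx u%:M 0 0 v%:M *m P.
Proof. by rewrite /class3 !jordan_pairE; apply: conj_classP. Qed.

Section NormalForm.
Variables A B C : 'M[K]_(2 + 2).
Hypotheses (hA : class1 a b A) (hB : class2 f g B) (hC : class3 u v C).
Hypothesis ABC : A *m B *m C = 1%:M.

Lemma unit_AB : (A \in unitmx) && (B \in unitmx).
Proof. by case/mulmx1_unit: ABC; rewrite unitmx_mul. Qed.

(** Multiplying (C - u)(C - v) = 0 by (A B)^2 eliminates [C]; what remains concerns [A] and [B]
    alone. *)
Lemma quadratic_AB : (A *m B) *m (A *m B) =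
  (u^-1 + v^-1) *: (A *m B) - ((u * v)^-1)%:M.
Proof.
set X := A *m B; have XC : X *m C = 1%:M by [].
have C2 : (C - u%:M) *m (C - v%:M) = 0.
  case/class3P: hC => P Pu PC.
  apply/eqP; rewrite (similar_eq0 Pu (similar_mul (similar_sub u PC) (similar_sub v PC))).
  rewrite !block_sub_scalar mulmx_block !subrr !mul0mx !mulmx0 !addr0.
  by rewrite block_mx0.
have : X *m X *m ((C - u%:M) *m (C - v%:M)) = 0 by rewrite C2 mulmx0.
have -> : X *m X *m ((C - u%:M) *m (C - v%:M)) =
    1%:M - (u + v) *: X + (u * v) *: (X *m X).
  have e1 c : X *m (C - c%:M) = 1%:M - c *: X.
    by rewrite mulmxBr XC mul_mx_scalar.
  have e2 : X *m X *m (C - v%:M) = X - v *: (X *m X).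
    by rewrite -mulmxA e1 mulmxBr mulmx1 -scalemxAr.
  rewrite mulmxA -[X *m X *m _]mulmxA e1 [X *m (_ - _)]mulmxBr mulmx1 -scalemxAr mulmxBl e1.
  rewrite -scalemxAl e2; move: {e1 e2 XC C2} (X *m X) => XX; clearbody X.
  by apply/matrixP => i j; rewrite !mxE; ring.
move/eqP; rewrite addr_eq0 => /eqP E.
apply: (scalerI (mulf_neq0 u0 v0)); rewrite scalerBr scalerA.
rewrite -[LHS]opprK -E opprB; congr (_ *: _ - _); first by field; rewrite ?u0 ?v0 ?g0 ?a0 ?f0 ?b0.
by rewrite scale_scalar_mx mulfV // mulf_neq0.
Qed.

(** Conjugate of the previous relation. In this order [B] acts first on row vectors, which suits
    eigenvectors of [B]. *)
Lemma quadratic_BA : (B *m A) *m (B *m A) =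
  (u^-1 + v^-1) *: (B *m A) - ((u * v)^-1)%:M.
Proof.
have /andP[Au _] := unit_AB.
have := congr1 (fun X => invmx A *m (X *m A)) quadratic_AB.
rewrite mulmxBl mulmxBr mul_scalar_mx -scalemxAl -!scalemxAr !mulmxA mulVmx //.
by rewrite mul1mx scalemx1.
Qed.

Lemma eigenvalue_A (x : 'rV_(2 + 2)) k : x != 0 -> x *m A = k *: x -> k = a \/ k = b.
Proof.
move=> x0 xA; case/class1P: hA => P Pu PA.
pose y : 'rV_(2 + 2) := x *m invmx P.
have yJ : y *m (block_mx (jmx a 1) 0 0 (jmx b 1)) = k *: y.
  have -> : block_mx (jmx a 1) 0 0 (jmx b 1) = P *m A *m invmx P.
    by rewrite PA mulmxK.
  by rewrite /y !mulmxA mulmxKV // xA scalemxAl.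
have [->|ka] := eqVneq k a; first by left.
have [->|kb] := eqVneq k b; first by right.
case/eqP: x0; rewrite -[x](mulmxKV Pu) -/y.
suff -> : y = 0 by rewrite mul0mx.
have kj c (w : 'rV_2) : k != c -> w *m jmx c 1 = k *: w -> w = 0.
  move=> kc wE; have ju : jmx (c - k) 1 \in unitmx.
    by rewrite unitmxE unitfE det_jmx expf_neq0 // subr_eq0 eq_sym.
  rewrite -[w](mulmxK ju); have -> : jmx (c - k) 1 = jmx c 1 - k%:M.
    by rewrite scalar_jmx jmxN jmxD oppr0 addr0.
  by rewrite mulmxBr wE mul_mx_scalar subrr mul0mx.
move: yJ; rewrite -[y]hsubmxK mul_row_block !mulmx0 add0r addr0 scale_row_mx.
by case/eq_row_mx => /(kj _ _ ka) -> /(kj _ _ kb) ->; rewrite row_mx0.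
Qed.

(** On such a nonzero vector B A would act by g k, a root of the quadratic relation: g k u = 1 or g
    k v = 1, against genericity. *)
Lemma no_common_eigenvector (x : 'rV_(2 + 2)) k :
  x *m B = g *: x -> x *m A = k *: x -> x = 0.
Proof.
move=> xB xA; apply/eqP; apply: contraT => x0.
have kE := eigenvalue_A x0 xA.
have xD : x *m (B *m A) = (g * k) *: x by rewrite mulmxA xB -scalemxAl xA scalerA.
have : (x *m (B *m A)) *m (B *m A) =
    ((u^-1 + v^-1) * (g * k) - (u * v)^-1) *: x.
  by rewrite -mulmxA quadratic_BA mulmxBr -scalemxAr xD mul_mx_scalar scalerA scalerBl.
rewrite xD -scalemxAl xD scalerA => /eqP.
rewrite -subr_eq0 -scalerBl scaler_eq0 (negbTE x0) orbF.
have -> : g * k * (g * k) - ((u^-1 + v^-1) * (g * k) - (u * v)^-1) =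
    (g * k - u^-1) * (g * k - v^-1) by field; rewrite ?u0 ?v0 ?g0 ?a0 ?f0 ?b0.
rewrite mulf_eq0 !subr_eq0 => /orP[] /eqP gk.
  have := generic1 kE (or_intror erefl) (or_introl erefl).
  by rewrite [k * g]mulrC gk mulVf // eqxx.
have := generic1 kE (or_intror erefl) (or_intror erefl).
by rewrite [k * g]mulrC gk mulVf // eqxx.
Qed.

Lemma cubic_B : (B - g%:M) *m (B - f%:M) *m (B - f%:M) = 0.
Proof.
case/class2P: hB => P Pu PB; have Pf := similar_sub f PB.
apply/eqP; rewrite (similar_eq0 Pu (similar_mul (similar_mul (similar_sub g PB) Pf) Pf)).
rewrite !block_sub_scalar !mulmx_block !subrr !mul0mx !mulmx0 !addr0.
rewrite ?add0r ?mul0mx ?mulmx0.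
have -> : jmx f 1 - f%:M = jmx 0 1.
  by rewrite scalar_jmx jmxN jmxD subrr oppr0 addr0.
rewrite -mulmxA jmxM !mul0r mulr0 addr0 -jmx0 mulmx0.
by rewrite block_mx0.
Qed.

(* A vector of both row spaces which is not an eigenvector of A spans with its image
   a plane on which A, B, AB have determinants a^2, g * lam, (u v)^-1, where lam is f
   or g: this contradicts genericity. *)
Lemma independent_AG (U G : 'M[K]_(2, 2 + 2)) :
  U *m A = jmx a 1 *m U -> G *m B = g *: G ->
  (forall r : 'rV_2, r *m U = 0 -> r = 0) ->
  (forall r : 'rV_2, r *m G = 0 -> r = 0) ->
  (col_mx U G : 'M_(2 + 2)) \in unitmx.
Proof.
move=> UA GB Uf Gf; apply: contraT => /row_ker_nunit[r r0].
rewrite -[r]hsubmxK mul_row_col => /eqP; rewrite addr_eq0 => /eqP xE.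
pose al : 'rV[K]_2 := lsubmx r; pose x := al *m U.
have xB : x *m B = g *: x.
  by rewrite /x /al xE -mulNmx -mulmxA GB -scalemxAr.
have x0 : x != 0.
  apply: contraNneq r0 => x0; rewrite -[r]hsubmxK -/al (Uf _ x0).
  move/eqP: xE; rewrite -/x x0 eq_sym oppr_eq0 => /eqP /Gf ->.
  by rewrite row_mx0.
pose nu : 'M[K]_2 := jmx 0 1; pose y := al *m nu *m U.
have UA' w : w *m U *m A = a *: (w *m U) + w *m nu *m U.
  rewrite -mulmxA UA mulmxA; have -> : jmx a 1 = a%:M + nu.
    by rewrite scalar_jmx jmxD addr0 add0r.
  by rewrite mulmxDr mulmxDl mul_mx_scalar scalemxAl.
have xA : x *m A = a *: x + y by rewrite UA'.
have yA : y *m A = a *: y.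
  rewrite UA' -[al *m nu *m nu]mulmxA jmxM !mul0r mulr0 addr0 -jmx0 mulmx0 mul0mx.
  by rewrite addr0.
have y0 : y != 0.
  apply: contraNneq x0 => y0; apply/eqP.
  by apply: (no_common_eigenvector xB (k := a)); rewrite xA y0 addr0.
(* On the plane of x and y, B A has determinant (u v)^-1 and trace u^-1 + v^-1; these dictate [lam]
   and [mu]. *)
pose lam := (u * v * g * a ^+ 2)^-1.
pose mu := ((u^-1 + v^-1) * a - (u * v * g)^-1 - a ^+ 2 * g) / a.
have /andP[Au _] := unit_AB.
have yB : y *m B = mu *: x + lam *: y.
  rewrite -[LHS](mulmxK Au) -[RHS](mulmxK Au); congr (_ *m _).
  have xBA : x *m (B *m A) = g *: (a *: x + y).
    by rewrite mulmxA xB -scalemxAl xA.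
  have : (x *m (B *m A)) *m (B *m A) = (u^-1 + v^-1) *: (g *: (a *: x + y))
      - (u * v)^-1 *: x.
    by rewrite -mulmxA quadratic_BA mulmxBr -scalemxAr xBA mul_mx_scalar.
  rewrite xBA -scalemxAl mulmxDl -scalemxAl xBA => E.
  rewrite -mulmxA; apply: (scalerI g0).
  have -> : g *: (y *m (B *m A)) = (u^-1 + v^-1) *: (g *: (a *: x + y))
      - (u * v)^-1 *: x - (g * a * g) *: (a *: x + y).
    rewrite -E; move: (a *: x + y) (y *m (B *m A)) => w z.
    by apply/rowP => i; rewrite !mxE; ring.
  rewrite mulmxDl -!scalemxAl xA yA.
  apply/rowP => i; rewrite !mxE /lam /mu; field; by rewrite ?u0 ?v0 ?g0 ?a0 ?f0 ?b0.
(* Since the cubic kills B, the coefficient of y forces [lam] to be g or f. *)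
have E3 : y *m ((B - g%:M) *m (B - f%:M) *m (B - f%:M)) =
   (mu * (lam - f) * (g - f) + (lam - g) * (lam - f) * mu) *: x
    + ((lam - g) * (lam - f) ^+ 2) *: y.
  have st (c d k : K) : (c *: x + d *: y) *m (B - k%:M) =
      (c * (g - k) + d * mu) *: x + (d * (lam - k)) *: y.
    rewrite mulmxBr mulmxDl -!scalemxAl xB yB mul_mx_scalar.
    by apply/rowP => i; rewrite !mxE; ring.
  rewrite !mulmxA; have := st 0 1 g; rewrite scale0r add0r scale1r => ->.
  by rewrite !st; congr (_ *: _ + _ *: _); ring.
rewrite cubic_B mulmx0 in E3.
have ind (c d : K) : 0 = c *: x + d *: y -> d = 0.
  move=> cd; have : (c *: x + d *: y) *m (A - a%:M) = c *: y.
    rewrite mulmxBr mulmxDl -!scalemxAl xA yA mul_mx_scalar.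
    by apply/rowP => i; rewrite !mxE; ring.
  rewrite -cd mul0mx => /esym/eqP; rewrite scaler_eq0 (negbTE y0) orbF => /eqP c0.
  by move: cd; rewrite c0 scale0r add0r => /esym/eqP; rewrite scaler_eq0 (negbTE y0) orbF => /eqP.
have {E3} /eqP := ind _ _ E3.
have G2 k2 : (k2 <= 2)%N ->
    a ^+ 2 * f ^+ k2 * g ^+ (2 - k2) * u * v != 1.
  move=> k22; apply/eqP => E.
  have [] // : [/\ 2 = 2, 2 = 1, k2 = 1 & 1 = 1]%N.
  apply: gen => //; first by rewrite leq_subr.
  by rewrite subnn expr0 mulr1 !expr1.
have laK : lam * (u * v * g * a ^+ 2) = 1.
  by rewrite mulVf // !mulf_neq0 // expf_neq0.
rewrite mulf_eq0 sqrf_eq0 !subr_eq0 => /orP[] /eqP lamE; rewrite lamE in laK.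
  by have /eqP[] := G2 0%N isT; rewrite -laK subn0; ring.
by have /eqP[] := G2 1%N isT; rewrite -laK subSS subn0; ring.
Qed.

(* A kernel vector of X lies in an invariant plane on which B is the scalar g, whence a
   common eigenvector. *)
Lemma transverse_AG (U G : 'M[K]_(2, 2 + 2)) (X D : 'M[K]_2) :
  G *m B = g *: G -> G *m A = X *m U + D *m G ->
  (forall r : 'rV_2, r *m G = 0 -> r = 0) -> X \in unitmx.
Proof.
move=> GB GA Gf; apply: contraT => /row_ker_nunit[r r0 rX].
pose w := r *m G; pose w' := r *m D *m G.
have inB (t : 'rV_2) : t *m G *m B = g *: (t *m G).
  by rewrite -mulmxA GB -scalemxAr.
have wA : w *m A = w'.
  by rewrite /w -mulmxA GA mulmxDr !mulmxA rX mul0mx add0r.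
have w0 : w != 0 by apply: contraNneq r0 => /Gf ->.
have wD : w *m (B *m A) = g *: w' by rewrite mulmxA inB -scalemxAl wA.
have w'D : g *: w' *m (B *m A) = (u^-1 + v^-1) *: (g *: w') - (u * v)^-1 *: w.
  by rewrite -wD -mulmxA quadratic_BA mulmxBr -scalemxAr mul_mx_scalar.
have w'A : (g * g) *: (w' *m A) = (u^-1 + v^-1) *: (g *: w') - (u * v)^-1 *: w.
  by rewrite -w'D -scalemxAl mulmxA inB -scalemxAl scalerA.
(* [z] is the image of w under B A - v^-1. If it vanishes, w is an eigenvector of B A for v^-1; if
   not, z is one for u^-1. *)
pose z := g *: w' - v^-1 *: w.
have zB : z *m B = g *: z.
  by rewrite /z mulmxBl -!scalemxAl !inB scalerBr !scalerA [v^-1 * g]mulrC.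
have [z0|zn0] := eqVneq z 0.
  case/eqP: w0; apply: (no_common_eigenvector (inB r) (k := (g * v)^-1)).
  rewrite wA -[w'](scalerK g0); move/eqP: z0; rewrite subr_eq0 => /eqP ->.
  by rewrite scalerA -invfM.
case/eqP: zn0; apply: (no_common_eigenvector zB (k := (g * u)^-1)).
apply: (scalerI g0); rewrite scalemxAl /z scalerBr mulmxBl !scalerA.
rewrite -[(g * g) *: w' *m A]scalemxAl w'A -scalemxAl wA.
by apply/rowP => i; rewrite !mxE; field; rewrite ?u0 ?v0 ?g0 ?a0 ?f0 ?b0.
Qed.

Lemma adapted_basis : exists (Q : 'M[K]_(2 + 2)) (be ph Y : 'M[K]_2),
  [/\ Q \in unitmx, Q *m A = block_mx (jmx a 1) 0 1%:M be *m Q &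
      Q *m B = block_mx ph Y 0 g%:M *m Q].
Proof.
have [P Pu PA] : exists2 P : 'M[K]_(2 + 2), P \in unitmx &
    P *m A = block_mx (jmx a 1) 0 0 (jmx b 1) *m P by apply/class1P.
have [P' P'u PB] : exists2 P : 'M[K]_(2 + 2), P \in unitmx &
    P *m B = block_mx (jmx f 1) 0 0 g%:M *m P by apply/class2P.
pose U := usubmx P; pose G := dsubmx P'.
have UA : U *m A = jmx a 1 *m U.
  move: PA; rewrite -[P]vsubmxK mul_col_mx mul_block_col !mul0mx addr0.
  by case/eq_col_mx.
have GB : G *m B = g *: G.
  move: PB; rewrite -[P']vsubmxK mul_col_mx mul_block_col !mul0mx add0r.
  by rewrite mul_scalar_mx => /eq_col_mx[].
have Uf (r : 'rV_2) : r *m U = 0 -> r = 0.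
  move=> rU; have : row_mx r 0 *m P = 0.
    by rewrite -[P]vsubmxK mul_row_col rU mul0mx addr0.
  move/(canRL (mulmxK Pu)); rewrite mul0mx -[RHS]row_mx0.
  by case/eq_row_mx.
have Gf (r : 'rV_2) : r *m G = 0 -> r = 0.
  move=> rG; have : row_mx 0 r *m P' = 0.
    by rewrite -[P']vsubmxK mul_row_col rG mul0mx addr0.
  move/(canRL (mulmxK P'u)); rewrite mul0mx -[RHS]row_mx0.
  by case/eq_row_mx.
pose Q0 : 'M[K]_(2 + 2) := col_mx U G.
have Q0u : Q0 \in unitmx by apply: independent_AG.
have split_rows (M : 'M[K]_(2, 2 + 2)) : exists X D : 'M[K]_2, M = X *m U + D *m G.
  exists (lsubmx (M *m invmx Q0)), (rsubmx (M *m invmx Q0)).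
  by rewrite -mul_row_col hsubmxK mulmxKV.
have [X [D GA]] := split_rows (G *m A).
have [ph [Y UB]] := split_rows (U *m B).
have Xu : X \in unitmx by apply: (transverse_AG GB GA Gf).
(* Changing the basis of the g-eigenplane by [invmx X] turns the coupling block into 1 and leaves
   the scalar block g unchanged. *)
exists (block_mx 1%:M 0 0 (invmx X) *m Q0), (invmx X *m D *m X), ph, (Y *m X).
have -> : block_mx 1%:M 0 0 (invmx X) *m Q0 = col_mx U (invmx X *m G).
  by rewrite /Q0 mul_block_col !mul0mx mul1mx addr0 add0r.
split.
- have -> : col_mx U (invmx X *m G) = block_mx 1%:M 0 0 (invmx X) *m Q0.
    by rewrite /Q0 mul_block_col !mul0mx mul1mx addr0 add0r.
  by rewrite unitmx_mul Q0u andbT unitmxE det_ublock det1 mul1r -unitmxE unitmx_inv.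
- rewrite mul_col_mx mul_block_col UA mul0mx addr0 mul1mx; congr col_mx.
  by rewrite -[LHS]mulmxA GA mulmxDr mulKmx // !mulmxA mulmxK.
- rewrite mul_col_mx mul_block_col UB mul0mx add0r mulmxA mulmxK //.
  by congr col_mx; rewrite -[LHS]mulmxA GB -scalemxAr mul_scalar_mx.
Qed.

Lemma normal_form : exists s (Q : 'M[K]_(2 + 2)),
  [/\ Q \in unitmx, s != 0, s + a^-1 != 0 &
  [/\ Q *m A = norm1 s *m Q, Q *m B = norm2 s *m Q & Q *m C = norm3 s *m Q]].
Proof.
have [Q [be [ph [Y [Qu QA QB]]]]] := adapted_basis.
have QBA := similar_mul QB QA.
set NA := block_mx (jmx a 1) _ _ _ in QA QBA.
set NB := block_mx ph _ _ _ in QB QBA.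
have NBA : (NB *m NA) *m (NB *m NA) =
    (u^-1 + v^-1) *: (NB *m NA) - ((u * v)^-1)%:M.
  apply: (can_inj (mulmxK Qu)); rewrite -(similar_mul QBA QBA) quadratic_BA.
  rewrite mulmxBr mulmxBl -scalemxAr -scalemxAl QBA scalar_mxC; done.
pose D := ph *m jmx a 1 + Y.
have NBAE : NB *m NA = block_mx D (Y *m be) g%:M (g *: be).
  by rewrite mulmx_block !mulmx0 !mul0mx mulmx1 !add0r mulmx1 mul_scalar_mx.
move: NBA; rewrite NBAE mulmx_block scale_block_mx [(_ ^-1)%:M]scalar_mx_block.
rewrite opp_block_mx add_block_mx !oppr0 !addr0 => /eq_block_mx[_ _ e21 e22].
(* The lower left block of the quadratic relation determines [Y]. *)
have YE : Y = (u^-1 + v^-1)%:M - ph *m jmx a 1 - g *: be.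
  have : g *: (D + g *: be) = g *: (u^-1 + v^-1)%:M.
    move: e21; rewrite mul_scalar_mx mul_mx_scalar -scalerDr => ->.
    by rewrite !scale_scalar_mx mulrC.
  by move/(scalerI g0) => <-; rewrite addrAC addrK /D addrAC subrr add0r.
(* After substitution of [Y], the lower right block leaves only (g u v)^-1, which is a b f. *)
have phE : ph *m jmx a 1 *m be = (a * b * f)%:M.
  apply: (scalerI g0); move: e22.
  rewrite mul_scalar_mx -scalemxAl -scalemxAr YE !mulmxBl mul_scalar_mx -scalemxAl.
  move: (ph *m jmx a 1 *m be) (be *m be) => M1 M2 E.
  rewrite scale_scalar_mx; have -> : g * (a * b * f) = (u * v)^-1.
    by apply: (mulIf (mulf_neq0 u0 v0)); rewrite mulVf ?mulf_neq0 // -prod1; ring.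
  rewrite -[RHS](subKr ((u^-1 + v^-1) *: (g *: be))) -E.
  by apply/matrixP => i j; rewrite !mxE; ring.
have trA : \tr be = b *+ 2.
  have [P Pu PA] : exists2 P : 'M[K]_(2 + 2), P \in unitmx &
    P *m A = block_mx (jmx a 1) 0 0 (jmx b 1) *m P by apply/class1P.
  have := similar_tr Qu QA; rewrite (similar_tr Pu PA) !mxtrace_block => /addrI <-.
  by rewrite trmx2E !jmxE.
have detA : \det be = b ^+ 2.
  have [P Pu PA] : exists2 P : 'M[K]_(2 + 2), P \in unitmx &
    P *m A = block_mx (jmx a 1) 0 0 (jmx b 1) *m P by apply/class1P.
  have := similar_det Qu QA; rewrite (similar_det Pu PA) !det_lblock !det_jmx.
  by move/mulfI => <- //; rewrite expf_neq0.
have [trB detB] : \tr ph = f *+ 2 /\ \det ph = f ^+ 2.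
  have [P Pu PB] : exists2 P : 'M[K]_(2 + 2), P \in unitmx &
    P *m B = block_mx (jmx f 1) 0 0 g%:M *m P by apply/class2P.
  have := similar_tr Qu QB; rewrite (similar_tr Pu PB) !mxtrace_block => /addIr <-.
  have := similar_det Qu QB; rewrite (similar_det Pu PB) !det_ublock.
  move/mulIf => <-; first by rewrite trmx2E !jmxE det_jmx.
  by rewrite det_scalar expf_neq0.
have [s [beE phJ]] := commuting_triple a0 b0 f0 trA detA trB detB phE.
have NAE : NA = norm1 s by rewrite /NA beE.
have NBE : NB = norm2 s.
  rewrite /NB /norm2 YE phJ beE; congr block_mx.
  rewrite jmxM scalar_jmx jmxZ !jmxN !jmxD; congr jmx; field; by rewrite ?a0.
exists s, Q; split=> //.
(* At s = 0 the block [be] is scalar, so (A - a)^2 (A - b) = 0, which the Jordan block of size 2 at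
   b forbids. *)
- apply/eqP => s0.
  have : (A - a%:M) *m (A - a%:M) *m (A - b%:M) == 0.
    have Pa := similar_sub a QA; have Pb := similar_sub b QA.
    rewrite (similar_eq0 Qu (similar_mul (similar_mul Pa Pa) Pb)) NAE /norm1 s0 mulr0.
    rewrite !block_sub_scalar !mulmx_block -[0 in X in _ == X]block_mx0.
    by apply/eqP; congr block_mx; rewrite !jmx_simp; congr jmx; ring.
  have [P Pu PA] : exists2 P : 'M[K]_(2 + 2), P \in unitmx &
    P *m A = block_mx (jmx a 1) 0 0 (jmx b 1) *m P by apply/class1P.
  have Pa := similar_sub a PA; have Pb := similar_sub b PA.
  rewrite (similar_eq0 Pu (similar_mul (similar_mul Pa Pa) Pb)).
  rewrite !block_sub_scalar !mulmx_block -[0 in X in _ == X]block_mx0.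
  move/eqP/eq_block_mx => [_ _ _]; rewrite !jmx_simp => /jmx_inj[_] E.
  have : (b - a) ^+ 2 == 0 by rewrite -[X in _ == X]E; apply/eqP; ring.
  by rewrite sqrf_eq0 subr_eq0 eq_sym (negbTE ab).
(* Here [ph] would be scalar, so (B - f)(B - g) = 0, which the Jordan block of size 2 at f
   forbids. *)
- apply/eqP => s0.
  have : (B - f%:M) *m (B - g%:M) == 0.
    have Pf := similar_sub f QB; have Pg := similar_sub g QB.
    rewrite (similar_eq0 Qu (similar_mul Pf Pg)) NBE /norm2 s0 mulr0.
    rewrite !block_sub_scalar !mulmx_block -[0 in X in _ == X]block_mx0.
    by apply/eqP; congr block_mx; rewrite !jmx_simp; congr jmx; ring.
  have [P Pu PB] : exists2 P : 'M[K]_(2 + 2), P \in unitmx &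
    P *m B = block_mx (jmx f 1) 0 0 g%:M *m P by apply/class2P.
  have Pf := similar_sub f PB; have Pg := similar_sub g PB.
  rewrite (similar_eq0 Pu (similar_mul Pf Pg)).
  rewrite !block_sub_scalar !mulmx_block -[0 in X in _ == X]block_mx0.
  move/eqP/eq_block_mx => [+ _ _ _]; rewrite !jmx_simp => /jmx_inj[_] E.
  have : f - g == 0 by rewrite -[X in _ == X]E; apply/eqP; ring.
  by rewrite subr_eq0 (negbTE fg).
rewrite -NAE -NBE; split=> //.
have -> : C = (u * v) *: ((u^-1 + v^-1)%:M - A *m B).
  have [Xu _] := mulmx1_unit ABC.
  rewrite -[C](mulKmx Xu) ABC -[RHS](mulKmx Xu); congr (_ *m _).
  rewrite -scalemxAr mulmxBr mul_mx_scalar quadratic_AB opprB addrC subrK.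
  by rewrite scale_scalar_mx mulfV // mulf_neq0.
rewrite /norm3 -NAE -NBE -scalemxAr -scalemxAl mulmxBr mulmxBl -scalar_mxC.
by rewrite (similar_mul QA QB).
Qed.

End NormalForm.
End Triples.

(** * Dimension of the variety of triples *)

Section FamilyMembers.
Variable K : fieldType.
Variables a b f g u v : K.
Hypotheses (a0 : a != 0) (b0 : b != 0) (f0 : f != 0)
    (g0 : g != 0) (u0 : u != 0) (v0 : v != 0)
    (ab : a != b) (fg : f != g) (uv : u != v)
    (prod1 : a * b * f * g * u * v = 1).

Definition scale2 c : 'M[K]_2 := \matrix_(i, j) (if i == j then (if i == 0 then 1 else c) else 0).

Lemma scale2_jmx c x : scale2 c *m jmx x c = jmx x 1 *m scale2 c.
Proof. by apply: mx2P; rewrite !mulmx2E !jmxE !mxE /=; ring. Qed.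

Lemma scale2_unit c : c != 0 -> scale2 c \in unitmx.
Proof.
by move=> c0; rewrite unitmxE unitfE detmx2E !mxE /= mul1r mulr0 subr0.
Qed.

Lemma norm1_class s : s != 0 -> class1 a b (norm1 a b s).
Proof.
move=> s0; apply/class1P.
have d0 : b - a != 0 by rewrite subr_eq0 eq_sym.
(* The inverse of the dual number [jmx b (b * s) - jmx a 1]: conjugation by it removes the coupling
   block. *)
pose r := jmx (b - a)^-1 (- (b * s - 1) / (b - a) ^+ 2).
exists (block_mx 1%:M 0 0 (scale2 (b * s)) *m block_mx 1%:M 0 r 1%:M).
  rewrite unitmx_mul !unitmxE !det_lblock !det1 !mul1r unitr1 andbT -unitmxE.
  by rewrite scale2_unit // mulf_neq0.
have E1 : block_mx 1%:M 0 r 1%:M *m norm1 a b s =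
    block_mx (jmx a 1) 0 0 (jmx b (b * s)) *m block_mx 1%:M 0 r 1%:M.
  rewrite !mulmx_block; congr block_mx; rewrite !jmx_simp; congr jmx; field; by rewrite ?d0.
rewrite -mulmxA E1 !mulmxA; congr (_ *m _).
by rewrite !mulmx_block !mul1mx !mulmx1 !mul0mx !mulmx0 !addr0 !add0r scale2_jmx.
Qed.

Lemma norm2_class s : s + a^-1 != 0 -> class2 f g (norm2 a b f g u v s).
Proof.
move=> s0; apply/class2P; set c := - f * (s + a^-1).
have c0 : c != 0 by rewrite mulf_neq0 // oppr_eq0.
have d0 : f - g != 0 by rewrite subr_eq0.
set Y0 := u^-1 + v^-1 - f * a - g * b.
set Y1 := (f * a - g * b) * s.
(* The quotient of dual numbers of Y0 + Y1 nu by (f - g) + c nu, which removes the upper right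
   block. *)
pose r := jmx (Y0 / (f - g)) ((Y1 - c * Y0 / (f - g)) / (f - g)).
exists (block_mx (scale2 c) 0 0 1%:M *m block_mx 1%:M r 0 1%:M).
  rewrite unitmx_mul !unitmxE !det_ublock !det1 !mulr1 -!unitmxE.
  by rewrite scale2_unit //= unitr1.
have E1 : block_mx 1%:M r 0 1%:M *m norm2 a b f g u v s =
    block_mx (jmx f c) 0 0 g%:M *m block_mx 1%:M r 0 1%:M.
  rewrite /norm2 -/c -/Y0 -/Y1; clearbody c Y0 Y1.
  rewrite !mulmx_block; congr block_mx; rewrite !jmx_simp; congr jmx; field; by rewrite ?d0.
rewrite -mulmxA E1 !mulmxA; congr (_ *m _).
by rewrite !mulmx_block !mul1mx !mulmx1 !mul0mx !mulmx0 !addr0 !add0r scale2_jmx.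
Qed.

Let gE : g = (a * b * f * u * v)^-1.
Proof.
apply: (mulIf (_ : a * b * f * u * v != 0)); first by rewrite !mulf_neq0.
by rewrite mulVf ?mulf_neq0 // -prod1; ring.
Qed.

Lemma norm3_diag s : exists2 P : 'M[K]_(2 + 2), P \in unitmx &
  P *m (norm1 a b s *m norm2 a b f g u v s) = block_mx u^-1%:M 0 0 v^-1%:M *m P.
Proof.
pose ph := jmx f (- f * (s + a^-1)); pose al : 'M[K]_2 := jmx a 1.
have d0 : u + -1 * v != 0 by rewrite mulN1r subr_eq0.
(* Over the commutative ring of dual numbers, the row (ph, k - al ph) is a left eigenvector of the
   product for k = u^-1 and k = v^-1. *)
pose x := u^-1%:M - al *m ph; pose y := v^-1%:M - al *m ph.
pose phV := jmx f^-1 ((s + a^-1) / f).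
pose e := (v^-1 - u^-1)^-1.
exists (block_mx ph x ph y).
  have e0 : v^-1 - u^-1 != 0.
    by rewrite subr_eq0; apply: contraNneq uv => /invr_inj ->.
  suff E : block_mx ph x ph y *m
      block_mx (e *: (y *m phV)) (- e *: (x *m phV)) (- e)%:M e%:M = 1%:M.
    by case/mulmx1_unit: E.
  rewrite [RHS]scalar_mx_block mulmx_block /e /x /y /ph /phV /al.
  congr block_mx; rewrite !jmx_simp; congr jmx; field; by rewrite ?u0 ?v0 ?f0 ?a0 ?d0.
rewrite /norm1 /norm2 !mulmx_block /x /y /ph /al.
congr block_mx; rewrite !jmx_simp; congr jmx; rewrite ?gE; field;
  by rewrite ?u0 ?v0 ?f0 ?a0 ?b0.
Qed.

Lemma norm3_class s : class3 u v (norm3 a b f g u v s).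
Proof.
apply/class3P; have [P Pu PX] := norm3_diag s; exists P => //.
rewrite /norm3 -scalemxAr mulmxBr PX scalar_mxC -mulmxBl scalemxAl; congr (_ *m _).
rewrite [(u^-1 + v^-1)%:M]scalar_mx_block opp_block_mx add_block_mx !oppr0 !addr0.
rewrite scale_block_mx !scaler0 -!raddfB /= !scale_scalar_mx.
by congr block_mx; congr (_%:M); field; rewrite ?u0 ?v0.
Qed.

Lemma norm_product s :
  norm1 a b s *m norm2 a b f g u v s *m norm3 a b f g u v s = 1%:M.
Proof.
have [P Pu PX] := norm3_diag s; set X := norm1 _ _ _ *m _ in PX *.
apply: (can_inj (mulKmx Pu)); rewrite mulmxA PX mulmx1 /norm3 -/X.
rewrite -mulmxA -scalemxAr mulmxBr PX scalar_mxC -mulmxBl scalemxAl mulmxA.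
rewrite -[RHS]mul1mx; congr (_ *m _).
rewrite [(u^-1 + v^-1)%:M]scalar_mx_block opp_block_mx add_block_mx !oppr0 !addr0.
rewrite scale_block_mx !scaler0 mulmx_block !mulmx0 !mul0mx !addr0 !add0r.
rewrite -!raddfB /= !scale_scalar_mx -!scalar_mxM [RHS]scalar_mx_block.
by congr block_mx; congr (_%:M); field; rewrite ?u0 ?v0.
Qed.

(** The two normal forms are triangular in opposite senses, so each yields a Sylvester equation for
    one off-diagonal block of [N], which vanishes. The identity block of [norm1] then makes the
    diagonal blocks equal. *)
Lemma norm_centralizer s (N : 'M[K]_(2 + 2)) : s != 0 ->
  N *m norm1 a b s = norm1 a b s *m N ->
  N *m norm2 a b f g u v s = norm2 a b f g u v s *m N ->
  exists r, N = block_mx (jrow r) 0 0 (jrow r).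
Proof.
move=> s0; rewrite -[N]submxK /norm1 /norm2 !mulmx_block.
set N1 := ulsubmx N; set N2 := ursubmx N; set N3 := dlsubmx N; set N4 := drsubmx N.
rewrite !mulmx0 !mul0mx !mulmx1 !mul1mx !addr0 !add0r.
move=> /eq_block_mx[e11 e12 e21 e22] /eq_block_mx[_ _ f21 _].
have N20 : N2 = 0 by apply: jmx_sylvester e12.
have N30 : N3 = 0.
  by apply: (@jmx_sylvester _ g 0 f (- f * (s + a^-1))); rewrite -?scalar_jmx // eq_sym.
rewrite N20 addr0 in e11; rewrite N20 add0r in e22.
have N1E := jmx_centralizer (oner_neq0 K) e11.
have N14 : N4 = N1 by move: e21; rewrite N30 mul0mx mulmx0 add0r addr0.
exists (\row_i (if i == 0 then N1 0 0 else N1 0 1)).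
by rewrite -jrowP -N1E N20 N30 N14.
Qed.

End FamilyMembers.

(** * The variety as a one-parameter family of orbits *)

Section TripleDimension.
Variable K : numFieldType.
Variables a b f g u v : K.
Hypotheses (a0 : a != 0) (b0 : b != 0) (f0 : f != 0)
    (g0 : g != 0) (u0 : u != 0) (v0 : v != 0)
    (ab : a != b) (fg : f != g) (uv : u != v)
    (prod1 : a * b * f * g * u * v = 1)
    (gen : relatively_generic a b f g u v).

Definition norm_triple (s : 'rV[K]_1) :
    ('M[K]_(2 + 2) * 'M[K]_(2 + 2) * 'M[K]_(2 + 2))%type :=
  (norm1 a b (s 0 0), norm2 a b f g u v (s 0 0), norm3 a b f g u v (s 0 0)).

(** Zero exactly where the Jordan block of size 2 at b or at f degenerates. *)
Definition admissible (s : 'rV[K]_1) : K := s 0 0 * (s 0 0 + a^-1).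

Lemma triplesE :
  triples (class1 a b) (class2 f g) (class3 u v) =
  conj_family (mx_triple K (2 + 2)) norm_triple admissible.
Proof.
apply/seteqP; split=> -[[A B] C] /=.
  case=> /= hA hB hC ABC.
  have [s [Q [Qu s0 sa [QA QB QC]]]] :=
    normal_form a0 b0 f0 g0 u0 v0 ab fg uv prod1 gen hA hB hC ABC.
  exists (invmx Q), (const_mx s); split.
  - by rewrite unitmx_inv.
  - by rewrite /admissible mxE mulf_neq0.
  by rewrite /mxconj /= invmxK /norm_triple mxE -QA -QB -QC !mulKmx.
case=> Q [s [Qu]]; rewrite /admissible mulf_eq0 negb_or => /andP[s0 sa].
have Pi : invmx Q \in unitmx by rewrite unitmx_inv.
rewrite /mxconj /norm_triple /=; set t := s 0 0 => -[-> -> ->].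
have conj_in (J M : 'M[K]_4) : conj_class J M ->
    conj_class J (Q *m (M *m invmx Q)).
  case/conj_classP => P Pu PM; apply/conj_classP; exists (P *m invmx Q).
    by rewrite unitmx_mul Pu.
  by rewrite -mulmxA mulKmx // !mulmxA PM.
split=> /=; [apply: conj_in.. |].
- exact: norm1_class.
- exact: norm2_class.
- exact: norm3_class.
have conjM (M N : 'M[K]_4) :
    Q *m (M *m invmx Q) *m (Q *m (N *m invmx Q)) = Q *m (M *m N *m invmx Q).
  by rewrite !mulmxA mulmxKV.
by rewrite !conjM norm_product // mul1mx mulmxV.
Qed.

(** One plane serves every parameter, because dual numbers commute with all blocks of every normal
    form. *)
Lemma norm_centralizer_dim (s0 : 'rV[K]_1) : s0 0 0 != 0 ->
  exists Z : {vspace 'M[K]_(2 + 2)}, [/\ \dim Z = 2,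
    forall s c, c \in Z ->
      lm (mx_triple K (2 + 2)) c (norm_triple s) =
      rm (mx_triple K (2 + 2)) (norm_triple s) c &
    forall N, lm (mx_triple K (2 + 2)) N (norm_triple s0) =
      rm (mx_triple K (2 + 2)) (norm_triple s0) N -> N \in Z].
Proof.
move=> s00; pose E (r : 'rV[K]_2) : 'M[K]_(2 + 2) := block_mx (jrow r) 0 0 (jrow r).
have El : linear E.
  by move=> c x y; rewrite /E !linearP scale_block_mx !scaler0 add_block_mx !addr0.
pose EL := GRing.isLinear.Build _ _ _ _ E El.
pose E' : {linear 'rV[K]_2 -> 'M[K]_(2 + 2)} := HB.pack E EL.
exists (limg (linfun E')); split.
- rewrite dim_limg_inj ?dimvf ?dim_matrix // => x.
  by rewrite /= /E -[RHS]block_mx0 => /eq_block_mx[/jrow_eq0].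
- move=> s c /mem_limg_linfun[r ->] /=.
  have e1 : E r *m norm1 a b (s 0 0) = norm1 a b (s 0 0) *m E r.
    rewrite /E /norm1 !mulmx_block /jrow; congr block_mx; rewrite !jmx_simp;
      congr jmx; ring.
  have e2 : E r *m norm2 a b f g u v (s 0 0) = norm2 a b f g u v (s 0 0) *m E r.
    rewrite /E /norm2 !mulmx_block /jrow; congr block_mx; rewrite !jmx_simp;
      congr jmx; ring.
  rewrite e1 e2; congr (_, _, _); rewrite /norm3 -scalemxAl -scalemxAr.
  by rewrite mulmxBl mulmxBr scalar_mxC mulmxA e1 -!mulmxA e2.
move=> N; rewrite /norm_triple /= => -[e1 e2 _].
apply: (mem_limg_linfun E' N).2.
exact: (norm_centralizer ab fg s00 e1 e2).
Qed.

Lemma polymap_norm_triple : polymap norm_triple.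
Proof.
have lin (M : 'M[K]_(2 + 2)) : polymap (fun t : 'rV[K]_1 => t 0 0 *: M).
  by apply: polymap_linear => c x y; rewrite !mxE scalerDl scalerA.
have p1 : polymap (fun t : 'rV[K]_1 => norm1 a b (t 0 0)).
  have -> : (fun t : 'rV[K]_1 => norm1 a b (t 0 0)) =
      (fun t => norm1 a b 0 + t 0 0 *: block_mx 0 0 0 (jmx 0 b)).
    apply/funext => t; rewrite scale_block_mx add_block_mx.
    by congr block_mx; rewrite !jmx_simp; congr jmx; ring.
  by apply: polymapD; [exact: polymap_cst | exact: lin].
have p2 : polymap (fun t : 'rV[K]_1 => norm2 a b f g u v (t 0 0)).
  have -> : (fun t : 'rV[K]_1 => norm2 a b f g u v (t 0 0)) =
      (fun t => norm2 a b f g u v 0 +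
        t 0 0 *: block_mx (jmx 0 (- f)) (jmx 0 (f * a - g * b)) 0 0).
    apply/funext => t; rewrite scale_block_mx add_block_mx.
    by congr block_mx; rewrite !jmx_simp; congr jmx; ring.
  by apply: polymapD; [exact: polymap_cst | exact: lin].
apply: polymap_pair; first exact: polymap_pair.
have sc (c : K) : polymap (fun M : 'M[K]_(2 + 2) => c *: M).
  by apply: polymap_linear => d x y; rewrite scalerDr !scalerA mulrC.
apply: (polymap_comp _ (sc (u * v))); apply: polymapD; first exact: polymap_cst.
have -> : (fun t : 'rV[K]_1 => - (norm1 a b (t 0 0) *m norm2 a b f g u v (t 0 0)))
  = (fun t => -1 *: (norm1 a b (t 0 0) *m norm2 a b f g u v (t 0 0))).
  by apply/funext => t; rewrite scaleN1r.
by apply: (polymap_comp _ (sc (-1))); apply: polymap_mulmx.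
Qed.

(* A covariant of triples: on the normal form of parameter t both terms are multiples
   of the same matrix, and they cancel exactly for t = s. *)
Definition norm_separator (s : K) (M : 'M[K]_(2 + 2) * 'M[K]_(2 + 2) * 'M[K]_(2 + 2))
    : 'M[K]_(2 + 2) :=
  let A := M.1.1 in let B := M.1.2 in
  (a - b) *: ((A - b%:M) *m (B - f%:M) *m (B - g%:M) *m (A - b%:M)) +
  (f * (s + a^-1) * (u^-1 + v^-1 - f * b - g * a)) *:
    ((A - b%:M) *m (A - b%:M) *m (A - a%:M)).

Lemma polymap_norm_separator s : polymap (norm_separator s).
Proof.
have p1 c : polymap (fun M : 'M[K]_(2 + 2) * 'M[K]_(2 + 2) * 'M[K]_(2 + 2) =>
    M.1.1 - c%:M).
  by apply: polymapD; [exact: polymap_linear | exact: polymap_cst].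
have p2 c : polymap (fun M : 'M[K]_(2 + 2) * 'M[K]_(2 + 2) * 'M[K]_(2 + 2) =>
    M.1.2 - c%:M).
  by apply: polymapD; [exact: polymap_linear | exact: polymap_cst].
have sc (c : K) : polymap (fun M : 'M[K]_(2 + 2) => c *: M).
  by apply: polymap_linear => d x y; rewrite scalerDr !scalerA mulrC.
apply: polymapD; apply: polymap_comp (sc _); by do !apply: polymap_mulmx.
Qed.

Lemma norm_separatorE s t : norm_separator s (norm_triple t) =
  ((s - t 0 0) * f * (u^-1 + v^-1 - f * b - g * a) * (a - b)) *:
    block_mx (jmx 0 (a - b)) 0 (jmx 0 1) 0.
Proof.
rewrite /norm_separator /norm_triple /= /norm1 /norm2 !block_sub_scalar.
rewrite !mulmx_block !scale_block_mx add_block_mx.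
by congr block_mx; rewrite !jmx_simp; congr jmx; field; rewrite ?a0 ?u0 ?v0.
Qed.

Lemma norm_separator_conj s Q M : Q \in unitmx ->
  norm_separator s (mxconj (mx_triple K (2 + 2)) Q M) =
  Q *m norm_separator s M *m invmx Q.
Proof.
move=> Qu; case: M => [[A B] C]; rewrite /norm_separator /mxconj /=.
have cs c X : Q *m (X *m invmx Q) - c%:M = Q *m ((X - c%:M) *m invmx Q).
  by rewrite mulmxBl mulmxBr mul_scalar_mx -scalemxAr mulmxV // scalemx1.
have cm X Y : Q *m (X *m invmx Q) *m (Q *m (Y *m invmx Q)) =
    Q *m ((X *m Y) *m invmx Q).
  by rewrite !mulmxA mulmxKV.
by rewrite !cs !cm [Q *m (_ *: _ + _)]mulmxDr [(_ + _) *m invmx Q]mulmxDl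
  -!scalemxAr -!scalemxAl !mulmxA.
Qed.

Lemma has_dim_triples :
  has_dim (triples (class1 a b) (class2 f g) (class3 u v)) 15.
Proof.
rewrite triplesE.
(* Two distinct admissible parameters: in characteristic zero, a^-1, 2 a^-1 and 3 a^-1 are all
   nonzero. *)
pose s0 : 'rV[K]_1 := const_mx a^-1; pose s1 : 'rV[K]_1 := const_mx (a^-1 *+ 2).
have s0E : s0 0 0 = a^-1 by rewrite mxE.
have s1E : s1 0 0 = a^-1 *+ 2 by rewrite mxE.
have aV0 : a^-1 != 0 by rewrite invr_eq0.
have q0 : admissible s0 != 0.
  by rewrite /admissible mxE mulf_neq0 // -mulr2n mulrn_eq0.
have q1 : admissible s1 != 0.
  by rewrite /admissible mxE -mulrSr mulf_neq0 // mulrn_eq0.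
have [|Z [dZ Zc Zs]] := @norm_centralizer_dim s0; first by rewrite mxE.
rewrite (_ : 15 = (4 * 4 - \dim Z).+1)%N; last by rewrite dZ.
apply: (has_dim_family1 (s0 := s0)) => //.
- exact: polymap_norm_triple.
- apply: polyfM; first by apply: polyf_linear => c x y; rewrite !mxE.
  apply: polyfD; last exact: polyf_cst.
  by apply: polyf_linear => c x y; rewrite !mxE.
(* If this factor of the separator vanished, f b and g a would have sum u^-1 + v^-1 and product (u
   v)^-1, so f b would be u^-1 or v^-1, against genericity. *)
pose tau := u^-1 + v^-1 - f * b - g * a.
have tau0 : tau != 0.
  apply/eqP => tau0; have : (f * b - u^-1) * (f * b - v^-1) = 0.
    have -> : (f * b - u^-1) * (f * b - v^-1) =
        - (f * b) * tau + (u * v)^-1 - a * b * f * g.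
      by rewrite /tau; field; rewrite ?u0 ?v0.
    rewrite tau0 mulr0 add0r; apply/eqP; rewrite subr_eq0; apply/eqP.
    by apply: (mulIf (mulf_neq0 u0 v0)); rewrite mulVf ?mulf_neq0 // -prod1; ring.
  move/eqP; rewrite mulf_eq0 !subr_eq0 => /orP[] /eqP E.
    have := generic1 ab fg uv gen (or_intror erefl) (or_introl erefl) (or_introl erefl).
    by rewrite [b * f]mulrC E mulVf // eqxx.
  have := generic1 ab fg uv gen (or_intror erefl) (or_introl erefl) (or_intror erefl).
  by rewrite [b * f]mulrC E mulVf // eqxx.
exists (fun M => norm_separator a^-1 M (lshift 2 0) (lshift 2 1)); split.
- apply: (polyf_comp (f := fun N : 'M[K]_(2 + 2) => N (lshift 2 0) (lshift 2 1))).
    by apply: polyf_linear => c x y; rewrite !mxE.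
  exact: polymap_norm_separator.
- move=> _ [Q Qu <-]; rewrite norm_separator_conj // norm_separatorE s0E subrr.
  by rewrite !mul0r scale0r mulmx0 mul0mx mxE.
exists (norm_triple s1).
  exists 1%:M, s1; split=> //; first exact: unitmx1.
  by rewrite mxconj1.
rewrite norm_separatorE s1E mxE block_mxEul jmxE01 !mulf_neq0 // ?subr_eq0 //.
by rewrite mulr2n eq_sym -subr_eq0 addrK.
Qed.

End TripleDimension.

Local Close Scope classical_set_scope.
Local Open Scope complex_scope.

Theorem proposition28 (R : realType) (a b f g u v : R[i])
    (a0 : a != 0) (b0 : b != 0) (f0 : f != 0)
    (g0 : g != 0) (u0 : u != 0) (v0 : v != 0)
    (ab : a != b) (fg : f != g) (uv : u != v)
    (prod1 : a * b * f * g * u * v = 1)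
    (gen : relatively_generic a b f g u v) :
  has_dim (triples (class1 a b) (class2 f g) (class3 u v)) 15 /\
  exists d1 d2 d3 : nat,
    [/\ has_dim (class1 a b) d1, has_dim (class2 f g) d2,
        has_dim (class3 u v) d3 &
        15%:Z = d1%:Z + d2%:Z + d3%:Z - 4%:Z ^+ 2 + 1].
Proof.
split; first exact: has_dim_triples.
exists 12, 10, 8; split=> //.
- exact: has_dim_class1.
- exact: has_dim_class2.
- exact: has_dim_class3.
Qed.
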